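(* Let $\sigma>0$, $\alpha\ge2$, $\rho\in(0,2]$. Suppose that the KKT system $$-B_1^*x^*\in\partial f_1(y^* ),\qquad -B_2^*x^*\in\partial f_2(z^* ),\qquad B_1y^*+B_2z^*-c=0$$ has a nonempty solution set, and that both $\Sigma_{f_1}+B_1^*B_1+\mathcal{T}_1$ and $\Sigma_{f_2}+B_2^*B_2+\mathcal{T}_2$ are positive definite. Let $\{\bar w^k\}=\{(\bar y^k,\bar z^k,\bar x^k)\}$ be the sequence generated by the accelerated preconditioned ADMM (accelerated pADMM) described in the context, let $w^*=(y^*,z^*,x^* )$ be the limit point of $\{(\bar y^k,\bar z^k,\bar x^k)\}$, and let $R_0=\|w^0-w^*\|_{\mathcal{M}}$. Let $\mathcal{R}$ be the KKT residual mapping and $h(\bar y^k,\bar z^k)$ the primal objective function value gap defined in the context. (a) If $\alpha=2$, then for all $k\ge0$, $$\|\mathcal{R}(\bar w^k)\|\le\left(\frac{\sigma\|B_1^*\|+1}{\sqrt\sigma}+\|\sqrt{\mathcal{T}_2}\|+\|\sqrt{\mathcal{T}_1}\|\right)\frac{2R_0}{\rho(k+1)}$$ and $$\left(\frac{-1}{\sqrt\sigma}\|x^*\|\right)\frac{2R_0}{\rho(k+1)}\le h(\bar y^k,\bar z^k)\le\left(3R_0+\frac{1}{\sqrt\sigma}\|x^*\|\right)\frac{2R_0}{\rho(k+1)}.$$ (b) If $\alpha>2$, then $$\|\mathcal{R}(\bar w^k)\|=\left(\frac{\sigma\|B_1^*\|+1}{\sqrt\sigma}+\|\sqrt{\mathcal{T}_2}\|+\|\sqrt{\mathcal{T}_1}\|\right)o\left(\frac{1}{k+1}\right)\quad\text{as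 }k\to+\infty$$ and $$|h(\bar y^k,\bar z^k)|=o\left(\frac{1}{k+1}\right)\quad\text{as }k\to+\infty.$$
   Context: Setting. $\mathbb{X},\mathbb{Y},\mathbb{Z}$ are finite-dimensional real Euclidean spaces, $\mathbb{W}:=\mathbb{Y}\times\mathbb{Z}\times\mathbb{X}$, $w=(y,z,x)$. $f_1:\mathbb{Y}\to(-\infty,+\infty]$ and $f_2:\mathbb{Z}\to(-\infty,+\infty]$ are proper closed convex functions; $B_1:\mathbb{Y}\to\mathbb{X}$ and $B_2:\mathbb{Z}\to\mathbb{X}$ are linear with adjoints $B_1^*,B_2^*$; $c\in\mathbb{X}$. The problem considered is $\min_{y,z} f_1(y)+f_2(z)$ subject to $B_1y+B_2z=c$. $\mathcal{T}_1$ and $\mathcal{T}_2$ are self-adjoint positive semidefinite linear operators on $\mathbb{Y}$ and $\mathbb{Z}$. For a self-adjoint positive semidefinite operator $\mathcal{S}$, $\|v\|_{\mathcal{S}}:=\sqrt{\langle v,\mathcal{S}v\rangle}$ and $\sqrt{\mathcal{S}}$ is its positive semidefinite square root; norms of linear operators are operator norms. $\Sigma_{f_1}$ and $\Sigma_{f_2}$ are self-adjoint positive semidefinite operators (which exist by convexity) such that for all $y,\hat y\in\operatorname{dom}(f_1)$, $\phi\in\partial f_1(y)$, $\hat\phi\in\partial f_1(\hat y)$: $f_1(y)\ge f_1(\hat y)+\langle\hat\phi,y-\hat y\rangle+\frac12\|y-\hat y\|^2_{\Sigma_{f_1}}$ and $\langle\phi-\hat\phi,y-\hat y\rangle\ge\|y-\hat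 y\|^2_{\Sigma_{f_1}}$; and similarly for $f_2$ and $\Sigma_{f_2}$ on $\mathbb{Z}$. $\mathcal{M}:\mathbb{W}\to\mathbb{W}$ is the self-adjoint positive semidefinite operator $$\mathcal{M}=\begin{bmatrix} \sigma B_1^*B_1+\mathcal{T}_1 & 0 & B_1^* \\ 0 & \mathcal{T}_2 & 0 \\ B_1 & 0 & \sigma^{-1}\mathcal{I} \end{bmatrix}.$$ Augmented Lagrangian: $L_\sigma(y,z;x)=f_1(y)+f_2(z)+\langle x,B_1y+B_2z-c\rangle+\frac{\sigma}{2}\|B_1y+B_2z-c\|^2$. Accelerated pADMM: choose $w^0=(y^0,z^0,x^0)\in\operatorname{dom}(f_1)\times\operatorname{dom}(f_2)\times\mathbb{X}$, set $\hat w^0=w^0$. For $k=0,1,\ldots$, with $\bar w^k=(\bar y^k,\bar z^k,\bar x^k)$: 1. $\bar z^k=\arg\min_{z\in\mathbb{Z}}\{L_\sigma(y^k,z;x^k)+\frac12\|z-z^k\|^2_{\mathcal{T}_2}\}$; 2. $\bar x^k=x^k+\sigma(B_1y^k+B_2\bar z^k-c)$; 3. $\bar y^k=\arg\min_{y\in\mathbb{Y}}\{L_\sigma(y,\bar z^k;\bar x^k)+\frac12\|y-y^k\|^2_{\mathcal{T}_1}\}$; 4. $\hat w^{k+1}=(1-\rho)w^k+\rho\bar w^k$; 5. $w^{k+1}=w^k+\frac{\alpha}{2(k+\alpha)}(\hat w^{k+1}-w^k)+\frac{k}{k+\alpha}(\hat w^{k+1}-\hat w^k)$. Under the stated assumptions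 $\{\bar w^k\}$ converges to a solution of the KKT system; ''limit point'' means this limit. KKT residual mapping: for $w=(y,z,x)\in\mathbb{W}$, $$\mathcal{R}(w)=\begin{pmatrix} y-\mathrm{Prox}_{f_1}(y-B_1^*x) \\ z-\mathrm{Prox}_{f_2}(z-B_2^*x) \\ c-B_1y-B_2z \end{pmatrix},$$ where $\mathrm{Prox}_f(v)=\arg\min_u\{f(u)+\frac12\|u-v\|^2\}$. Primal objective function value gap: $h(\bar y^k,\bar z^k):=f_1(\bar y^k)+f_2(\bar z^k)-f_1(y^* )-f_2(z^* )$, where $(y^*,z^* )$ is the limit of $\{(\bar y^k,\bar z^k)\}$.
   Formalization: In step 1 the term f_1(y^k), constant in z, is dropped from L_σ(y^k,z;x^k): extrapolation can take y^k outside dom(f_1), where the written objective is identically +∞ and its argmin is undefined; when f_1(y^k) is finite, the step is unchanged. *)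

(* Defs.v *)
From HB Require Import structures.
From mathcomp Require Import all_boot all_order all_algebra.
From mathcomp Require Import all_classical all_reals all_analysis.

Set Implicit Arguments.
Unset Strict Implicit.
Unset Printing Implicit Defensive.

Import Order.TTheory GRing.Theory Num.Theory.
Import numFieldNormedType.Exports.

Local Open Scope classical_set_scope.
Local Open Scope ring_scope.

(* Finite-dimensional real Euclidean spaces: the norm (hence the topology) of
   the normed module is the one induced by the inner product.  Positive
   definiteness of [dot] follows from [sqr_normE]. *)
HB.mixin Record isEuclidean (R : realType) V
    & Vector R V & NormedModule R V := {
  dot : V -> V -> R ;
  dotC : forall u v : V, dot u v = dot v u ;
  dot_linearl : forall (a : R) (u v w : V),
    dot (a *: u + v) w = a * dot u w + dot v w ;
  sqr_normE : forall u : V, `|u| ^+ 2 = dot u u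
}.

#[short(type="euclideanType")]
HB.structure Definition Euclidean (R : realType) :=
  { V of Vector R V & NormedModule R V & isEuclidean R V }.

Section Operators.
Context {R : realType}.

Definition is_adjoint {U V : euclideanType R}
    (A : 'Hom(U, V)) (As : 'Hom(V, U)) : Prop :=
  forall u v, dot (A u) v = dot u (As v).

Definition self_adjoint {V : euclideanType R} (A : 'End(V)) : Prop :=
  is_adjoint A A.

Definition psd_op {V : euclideanType R} (A : 'End(V)) : Prop :=
  self_adjoint A /\ forall v, 0 <= dot v (A v).

Definition pd_op {V : euclideanType R} (A : 'End(V)) : Prop :=
  self_adjoint A /\ forall v, v != 0 -> 0 < dot v (A v).

Definition is_sqrt_op {V : euclideanType R} (A S : 'End(V)) : Prop :=
  psd_op S /\ (S \o S)%VF = A.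

Definition opnorm {U V : euclideanType R} (A : 'Hom(U, V)) : R :=
  sup [set `|A u| | u in [set u : U | `|u| <= 1]].

Definition seminorm_op {V : euclideanType R} (S : 'End(V)) (v : V) : R :=
  Num.sqrt (dot v (S v)).

End Operators.

Section ConvexAnalysis.
Context {R : realType} {V : euclideanType R}.
Implicit Types (f : V -> \bar R).

Definition edom f : set V := [set v | (f v < +oo)%E].

Definition proper_fun f : Prop :=
  (forall v, f v != -oo%E) /\ edom f !=set0.

Definition econvex f : Prop :=
  forall (u v : V) (t : R), 0 < t < 1 ->
    (f (t *: u + (1 - t) *: v)%R <= t%:E * f u + (1 - t)%:E * f v)%E.

(* "closed" is lower semicontinuity *)
Definition proper_closed_convex f : Prop :=
  [/\ proper_fun f, lower_semicontinuous f & econvex f].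

(* For proper f the inequality forces f v to be finite. *)
Definition subdiff f (v : V) : set V :=
  [set phi | forall u : V, (f v + (dot phi (u - v))%:E <= f u)%E].

Definition is_argmin f (v : V) : Prop := forall u, (f v <= f u)%E.

Definition prox f (v : V) : V :=
  get [set p | is_argmin (fun u => f u + (2^-1 * `|u - v| ^+ 2)%:E)%E p].

Definition convexity_modulus f (S : 'End(V)) : Prop :=
  forall v v' phi phi' : V,
    edom f v -> edom f v' -> subdiff f v phi -> subdiff f v' phi' ->
    (f v' + (dot phi' (v - v') + 2^-1 * seminorm_op S (v - v') ^+ 2)%:E
       <= f v)%E
    /\ seminorm_op S (v - v') ^+ 2 <= dot (phi - phi') (v - v').

End ConvexAnalysis.

Section ADMM.
Context {R : realType} {X Y Z : euclideanType R}.

(* w = (y, z, x).  The library norm on a product is the max norm, so the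
   Euclidean structure of the product is given explicitly. *)
Local Notation W := (Y * Z * X)%type.

Definition yc (w : W) : Y := w.1.1.
Definition zc (w : W) : Z := w.1.2.
Definition xc (w : W) : X := w.2.

Definition dotW (w w' : W) : R :=
  dot (yc w) (yc w') + dot (zc w) (zc w') + dot (xc w) (xc w').

Definition normW (w : W) : R := Num.sqrt (dotW w w).

Variables (f1 : Y -> \bar R) (f2 : Z -> \bar R).
Variables (B1 : 'Hom(Y, X)) (B2 : 'Hom(Z, X)).
Variables (B1s : 'Hom(X, Y)) (B2s : 'Hom(X, Z)) (c : X).
Variables (T1 : 'End(Y)) (T2 : 'End(Z)) (sigma : R).

Definition opM (w : W) : W :=
  (sigma *: B1s (B1 (yc w)) + T1 (yc w) + B1s (xc w),
   T2 (zc w),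
   B1 (yc w) + sigma^-1 *: xc w).

Definition normM (w : W) : R := Num.sqrt (dotW w (opM w)).

Definition KKT (w : W) : Prop :=
  [/\ subdiff f1 (yc w) (- B1s (xc w)),
      subdiff f2 (zc w) (- B2s (xc w)) &
      B1 (yc w) + B2 (zc w) - c = 0].

Definition KKTres (w : W) : W :=
  (yc w - prox f1 (yc w - B1s (xc w)),
   zc w - prox f2 (zc w - B2s (xc w)),
   c - B1 (yc w) - B2 (zc w)).

Definition augLag (g1 : Y -> \bar R) (g2 : Z -> \bar R)
    (y : Y) (z : Z) (x : X) : \bar R :=
  (g1 y + g2 z + (dot x (B1 y + B2 z - c)
                  + sigma / 2 * `|B1 y + B2 z - c| ^+ 2)%:E)%E.

(* In the z-update the term f1(y^k) does not depend on z and is dropped: after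
   extrapolation y^k may lie outside dom f1, where keeping this term would make
   the objective constantly +oo.  In the y-update f2(zbar^k) is finite. *)
Definition accelerated_pADMM (alpha rho : R) (w wbar what : nat -> W) : Prop :=
  [/\ edom f1 (yc (w 0%N)), edom f2 (zc (w 0%N)), what 0%N = w 0%N &
  forall k : nat,
  [/\ is_argmin (fun z => augLag (cst 0%E) f2 (yc (w k)) z (xc (w k))
        + (2^-1 * seminorm_op T2 (z - zc (w k)) ^+ 2)%:E)%E (zc (wbar k)),
      xc (wbar k)
        = xc (w k) + sigma *: (B1 (yc (w k)) + B2 (zc (wbar k)) - c),
      is_argmin (fun y => augLag f1 f2 y (zc (wbar k)) (xc (wbar k))
        + (2^-1 * seminorm_op T1 (y - yc (w k)) ^+ 2)%:E)%E (yc (wbar k)),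
      what k.+1 = (1 - rho) *: w k + rho *: wbar k &
      w k.+1 = w k + (alpha / (2 * (k%:R + alpha))) *: (what k.+1 - w k)
                   + (k%:R / (k%:R + alpha)) *: (what k.+1 - what k)]].

Definition obj_gap (w wstar : W) : \bar R :=
  (f1 (yc w) + f2 (zc w) - f1 (yc wstar) - f2 (zc wstar))%E.

End ADMM.

(* Main.v *)
(* With T the KKT operator and M the operator of the theorem, one pADMM step
   reads M (w - wbar) \in T wbar, so everything takes place in the seminorm of
   M, and only monotonicity of T is used.

   Put g_k = w^k - what^{k+1} = rho (w^k - wbar^k) and e_k = w^k - what^k. Then
     (k + alpha) e_{k+1} = k e_k + (alpha / 2) g_k,
     w^{k+1} = w^k + e_{k+1} - g_k,
   and <g_{k+1} - g_k, w^{k+1} - w^k> >= |g_{k+1} - g_k|^2 / 2. The last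
   inequality says that phi_k = |g_k|^2 / 2 - <g_k, e_k> satisfies
   (k + alpha) phi_{k+1} <= k phi_k; hence phi_k <= 0 for k >= 1, and
   |g_k| <= 2 |e_k|.
   If alpha = 2, then k e_k = w^0 - w^k and phi_k <= 0 gives
   (k + 1) |g_k| <= 2 |w^0 - w*|. If alpha > 2, then, with
   b = alpha / 2 - 1 and p_k = w^k - w*, the energy
   |k e_k + (alpha / 2) p_k|^2 + (b alpha / 2) |p_k|^2 decreases by at least
   2 b (k + 1) |e_{k+1}|^2. So k |e_k|^2 is summable, and since the increments
   of |k e_k|^2 are controlled by these summable terms, k e_k tends to 0.

   The limit of wbar is a KKT point because M (w^k - wbar^k) tends to 0 and the
   graph of T is closed. The residual is bounded by |M (w^k - wbar^k)|
   by nonexpansiveness of the prox; the gap is bounded by the subgradient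
   inequalities at wbar^k and at w*. *)
Require Import Defs.
From mathcomp Require Import all_boot all_order all_algebra.
From mathcomp Require Import all_classical all_reals all_analysis.
From mathcomp Require Import zify ring lra.
Set Implicit Arguments.
Unset Strict Implicit.
Unset Printing Implicit Defensive.

Import Order.TTheory GRing.Theory Num.Theory.
Import numFieldNormedType.Exports.
Local Open Scope classical_set_scope.
Local Open Scope ring_scope.

(** * Semi-inner products *)

(** Definiteness is left out because [<u, M v>] is only semidefinite. The carrier is a bare
    [lmodType], so that the product space is covered although its library norm is not the Euclidean
    one. *)
Definition semi_inner {R : realType} {W : lmodType R} (q : W -> W -> R) :=
  [/\ forall u v, q u v = q v u,
      forall (a : R) u v w, q (a *: u + v) w = a * q u w + q v w
    & forall u, 0 <= q u u].

Section SemiInner.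
Context {R : realType} {W : lmodType R} (q : W -> W -> R) (Hq : semi_inner q).

Lemma semi_innerC u v : q u v = q v u. Proof. by case: Hq. Qed.

Lemma semi_inner_ge0 u : 0 <= q u u. Proof. by case: Hq. Qed.

Lemma semi_innerDl u v w : q (u + v) w = q u w + q v w.
Proof. by case: Hq => _ H _; rewrite -{1}(scale1r u) H mul1r. Qed.

Lemma semi_inner0l w : q 0 w = 0.
Proof. by apply: (addrI (q 0 w)); rewrite -semi_innerDl !addr0. Qed.

Lemma semi_innerZl a u w : q (a *: u) w = a * q u w.
Proof. by case: Hq => _ H _; rewrite -(addr0 (a *: u)) H semi_inner0l addr0. Qed.

Lemma semi_innerNl u w : q (- u) w = - q u w.
Proof. by rewrite -scaleN1r semi_innerZl mulN1r. Qed.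

Lemma semi_innerDr u v w : q w (u + v) = q w u + q w v.
Proof. by rewrite semi_innerC semi_innerDl !(semi_innerC w). Qed.

Lemma semi_innerZr a u w : q w (a *: u) = a * q w u.
Proof. by rewrite semi_innerC semi_innerZl (semi_innerC w). Qed.

Lemma semi_innerNr u w : q w (- u) = - q w u.
Proof. by rewrite semi_innerC semi_innerNl (semi_innerC w). Qed.

Definition semi_innerE := (semi_innerDl, semi_innerDr, semi_innerZl,
  semi_innerZr, semi_innerNl, semi_innerNr).

Lemma semi_inner_CauchySchwarz u v :
  `|q u v| <= Num.sqrt (q u u) * Num.sqrt (q v v).
Proof.
have uu := semi_inner_ge0 u; have vv := semi_inner_ge0 v.
rewrite -sqrtrM // -sqrtr_sqr ler_sqrt; last by rewrite mulr_ge0.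
case: (ltrP 0 (q v v)) => [v0|v0].
  have := semi_inner_ge0 (u - (q u v / q v v) *: v).
  rewrite !semi_innerE (semi_innerC v u) => h.
  suff : 0 <= (q u u * q v v - q u v ^+ 2) / q v v.
    by rewrite pmulr_lge0 ?invr_gt0// subr_ge0.
  apply: le_trans h _; rewrite le_eqVlt; apply/orP; left; apply/eqP.
  by field; rewrite gt_eqF.
have vz : q v v = 0 by apply/eqP; rewrite eq_le v0 vv.
case: (eqVneq (q u v) 0) => [->|uv0]; first by rewrite vz mulr0 expr0n.
(* With [q v v = 0] the square is affine in the coefficient of [v]; this coefficient makes it equal
   to [-1], a contradiction. *)
have := semi_inner_ge0 (u - ((q u u + 1) / (2 * q u v)) *: v).
rewrite !semi_innerE (semi_innerC v u) vz.
have -> : (q u u + 1) / (2 * q u v) * q u v = (q u u + 1) / 2 by field.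
lra.
Qed.

Lemma semi_inner_le u v : q u v <= Num.sqrt (q u u) * Num.sqrt (q v v).
Proof. exact: le_trans (ler_norm _) (semi_inner_CauchySchwarz u v). Qed.

End SemiInner.

(** * Accelerated iterations of a cocoercive map *)

(* The increments are summable, so [A] has a limit, which must be [0] because the
   harmonic series diverges. *)
Lemma nonneg_slow_growth_cvg0 {R : realType} (A : R^nat) (C S : R) :
  (forall k, 0 <= A k) -> 0 <= C ->
  (forall n, \sum_(0 <= k < n) A k / k%:R <= S) ->
  (forall k, (0 < k)%N ->
     A k.+1 <= A k + C * (A k / k%:R + A k.+1 / k.+1%:R)) ->
  A @ \oo --> (0 : R).
Proof.
move=> A0 C0 HS HA.
pose s n := \sum_(0 <= k < n) A k / k%:R.
have s0 k : 0 <= A k / k%:R by rewrite divr_ge0.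
have sS n : s n.+1 = s n + A n / n%:R by rewrite /s big_nat_recr.
have snd : nondecreasing_seq s.
  apply/nondecreasing_seqP => n.
  by rewrite sS lerDl.
have scv : cvgn s.
  apply: nondecreasing_is_cvgn => //.
  by exists S => _ [n _ <-]; exact: HS.
(* Subtracting partial sums turns the growth bound into monotonicity: [t] is nonincreasing from
   index 1 on, since the bound is given for [0 < k]. Then [A] is recovered from convergent
   sequences. *)
pose t n := A n - C * (s n + s n.+1).
have tS n : t n.+2 <= t n.+1.
  have := HA n.+1 isT.
  rewrite /t !(sS n.+2) !(sS n.+1).
  move: (A n.+1 / _) (A n.+2 / _) => a b; lra.
have tcv : cvgn (fun n => t n.+1).
  apply: nonincreasing_is_cvgn; first exact/nonincreasing_seqP.
  exists (- (C * (S + S))) => _ [n _ <-]; rewrite /t.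
  have h1 := HS n.+1; have h2 := HS n.+2.
  have : C * (s n.+1 + s n.+2) <= C * (S + S) by rewrite ler_wpM2l// lerD.
  have := A0 n.+1; lra.
have scv1 : cvgn (fun n => s n.+1).
  by apply/cvg_ex; exists (limn s); rewrite (cvg_shiftS s).
have scv2 : cvgn (fun n => s n.+2).
  apply/cvg_ex; exists (limn s).
  by rewrite (cvg_shiftS (fun n => s n.+1)) (cvg_shiftS s).
have Acv : cvgn (fun n => A n.+1).
  have -> : (fun n => A n.+1) =
    (fun n => t n.+1) \+ (fun n => C * ((fun n => s n.+1) \+ (fun n => s n.+2)) n).
    by apply/funext => n /=; rewrite /t; ring.
  apply: (is_cvgD tcv); apply: is_cvgMr; exact: (is_cvgD scv1 scv2).
have [L HL] : exists L : R, (fun n => A n.+1) @ \oo --> L.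
  by exists (limn (fun n => A n.+1)).
have L0 : 0 <= L.
  rewrite -(cvg_lim _ HL)//; apply: limr_ge => //.
  by apply: nearW => n.
suff e0 : L = 0 by move: HL; rewrite e0 (cvg_shiftS A).
apply/eqP; rewrite eq_le L0 andbT leNgt; apply/negP => Lp.
have : \forall n \near \oo, L / 2 <= A n.+1.
  have L2 : 0 < L / 2 by rewrite divr_gt0.
  have /cvgrPdist_lt /(_ _ L2) := HL.
  apply: filterS => n; rewrite ltr_norml => /andP[h1 h2]; lra.
move=> [N _ HN].
apply: (@dvg_harmonic R).
apply: nondecreasing_is_cvgn.
  apply/nondecreasing_seqP => n.
  by rewrite /series /= big_nat_recr//= lerDl invr_ge0.
(* Beyond [N], the term [1/(k+1)] is at most [2/L] times [A k.+1 / k.+1%:R], and sums of the latter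
   stay below [S]. *)
exists (series (@harmonic R) N + 2 / L * S) => _ [n _ <-].
have [nN|Nn] := leqP n N.
  have : series (@harmonic R) n <= series (@harmonic R) N.
    have h : nondecreasing_seq (series (@harmonic R)).
      apply/nondecreasing_seqP => k.
      by rewrite /series /= big_nat_recr//= lerDl invr_ge0.
    exact: h.
  have : 0 <= 2 / L * S.
    rewrite mulr_ge0 ?divr_ge0 ?(ltW Lp)//.
    by apply: le_trans (HS 0%N); rewrite big_geq.
  lra.
rewrite /series /= (@big_cat_nat _ _ _ N) //=; last exact: ltnW.
rewrite lerD2l.
apply: le_trans (_ : 2 / L * \sum_(N <= k < n) A k.+1 / k.+1%:R <= _).
  rewrite mulr_sumr !big_nat; apply: ler_sum => k /andP[Nk _].
  rewrite /harmonic mulrA -[leLHS]mul1r ler_wpM2r ?invr_ge0//.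
  rewrite mulrAC ler_pdivlMr // mul1r; have := HN k Nk; rewrite /=; lra.
rewrite ler_wpM2l ?divr_ge0 ?(ltW Lp)//.
apply: le_trans (HS n.+1); rewrite [leRHS]big_nat_recl //=.
rewrite (@big_cat_nat _ _ _ N 0 n) //=; last exact: ltnW.
by rewrite addrA lerDr addr_ge0 ?sumr_ge0.
Qed.

(** * Estimates for the recursion in [w], [e] and [g] *)

Section AcceleratedKM.
Context {R : realType} {W : lmodType R} (q : W -> W -> R) (Hq : semi_inner q).
Variables (alpha : R) (w e g : nat -> W) (ws : W).
Hypotheses (alpha2 : 2 <= alpha)
  (wS : forall k, w k.+1 = w k + e k.+1 - g k)
  (eS : forall k,
     (k%:R + alpha) *: e k.+1 = k%:R *: e k + (alpha / 2) *: g k)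
  (g_cocoercive : forall k,
     q (g k.+1 - g k) (g k.+1 - g k) <= 2 * q (g k.+1 - g k) (w k.+1 - w k))
  (g_cocoercive_sol : forall k, q (g k) (g k) <= 2 * q (g k) (w k - ws)).

Let alpha0 : 0 <= alpha. Proof. exact: le_trans alpha2. Qed.

Let ka_gt0 k : 0 < k%:R + alpha.
Proof. by rewrite ltr_wpDl// (lt_le_trans _ alpha2). Qed.

Let q_wS k x : q (w k.+1) x = q (w k) x + q (e k.+1) x - q (g k) x.
Proof. by rewrite wS !(semi_innerE Hq). Qed.

Let q_eS k x :
  (k%:R + alpha) * q (e k.+1) x = k%:R * q (e k) x + alpha / 2 * q (g k) x.
Proof. by rewrite -(semi_innerZl Hq) eS !(semi_innerE Hq). Qed.

(** This is [phi_k <= 0] for [k >= 1]. The factor [k%:R] makes [k = 0] trivial, where the sign of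
    [phi_0] is unknown; the recursion at 0 has a zero right-hand side, so [phi_1 <= 0] in any
    case. *)
Lemma accelerated_g_le_ge k : k%:R * q (g k) (g k) <= 2 * (k%:R * q (g k) (e k)).
Proof.
have step j : (j%:R + alpha) * (2^-1 * q (g j.+1) (g j.+1) - q (g j.+1) (e j.+1))
   <= j%:R * (2^-1 * q (g j) (g j) - q (g j) (e j)).
  have h1 := q_eS j (g j).
  have h2 := g_cocoercive j.
  rewrite !(semi_innerC Hq (e _)) in h1.
  have h4 x : q x (w j.+1) = q x (w j) + q x (e j.+1) - q x (g j).
    by rewrite (semi_innerC Hq) q_wS !(semi_innerC Hq _ x).
  rewrite !(semi_innerE Hq) !h4 (semi_innerC Hq (g j) (g j.+1)) in h2.
  set G1 := q (g j.+1) (g j.+1) in h2 *.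
  set G0 := q (g j) (g j) in h1 h2 *.
  (* Cocoercivity with [w_{j+1} - w_j = e_{j+1} - g_j]. After multiplication by [j + alpha], the
     recursion for [e_{j+1}] cancels the terms [(alpha / 2) |g_j|^2]. *)
  have h3 : 2^-1 * G1 - q (g j.+1) (e j.+1) <= 2^-1 * G0 - q (g j) (e j.+1) by lra.
  apply: le_trans (ler_wpM2l (ltW (ka_gt0 j)) h3) _.
  rewrite mulrBr h1; lra.
case: k => [|k]; first by rewrite !mul0r mulr0.
have : 2^-1 * q (g k.+1) (g k.+1) - q (g k.+1) (e k.+1) <= 0.
  elim: k => [|k IH].
    have := step 0%N; rewrite mul0r pmulr_rle0 //.
  have h := le_trans (step k.+1).
  by rewrite -(pmulr_rle0 _ (ka_gt0 k.+1)); apply: h; rewrite pmulr_rle0.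
move=> h; have := ler_wpM2l (ler0n R k.+1) h; lra.
Qed.

(** Expanding [|g_k - 2 e_k|^2 >= 0] replaces a division by a seminorm that may vanish. *)
Lemma accelerated_g_le_e k : k%:R * q (g k) (g k) <= 4 * (k%:R * q (e k) (e k)).
Proof.
have h1 := accelerated_g_le_ge k.
have := semi_inner_ge0 Hq (g k - 2 *: e k).
rewrite !(semi_innerE Hq) (semi_innerC Hq (e k)) => h2.
have := mulr_ge0 (ler0n R k) h2; lra.
Qed.

Let pS p k x : p = (fun k => w k - ws) ->
  q (p k) x = q (p k.+1) x - q (e k.+1) x + q (g k) x.
Proof. by move->; rewrite !(semi_innerE Hq) q_wS; ring. Qed.

Let p_g_ge0 k : q (g k) (g k) <= 2 * q (w k - ws) (g k).
Proof. by rewrite (semi_innerC Hq (_ - _)). Qed.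

(** Moving one copy of [e_{k+1}] to the right in the recursion leaves
    [(k+1) e_{k+1} = k e_k - (w_{k+1} - w_k)], which telescopes. *)
Lemma accelerated2_e k : alpha = 2 -> k%:R *: e k = w 0 - w k.
Proof.
move=> a2; elim: k => [|k IH]; first by rewrite scale0r subrr.
have -> : k.+1%:R *: e k.+1 = (k%:R + 2) *: e k.+1 - e k.+1.
  by rewrite -[k.+1%:R]natr1 -{3}(scale1r (e _)) -scalerBl; congr (_ *: _); ring.
by rewrite -{1}a2 eS IH a2 divff// scale1r wS !opprD opprK !addrA addrAC.
Qed.

(** For [alpha = 2] this is a Halpern iteration anchored at [w 0]:
    [(k+2) p_{k+1} = p_0 + (k+1) (p_k - g_k)] with [p_k = w k - ws], and cocoercivity gives
    [|p_k - g_k| <= |p_k|]. *)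
Lemma accelerated2_dist k : alpha = 2 ->
  q (w k - ws) (w k - ws) <= q (w 0 - ws) (w 0 - ws).
Proof.
move=> a2; elim: k => // k IH.
set p' := w k.+1 - ws; set p0 := w 0 - ws; pose b := w k - ws - g k.
have h x : (k%:R + 2) * q p' x = q p0 x + (k%:R + 1) * q b x.
  have eE : q (e k.+1) x = q (w k.+1) x - q (w k) x + q (g k) x.
    by rewrite q_wS; ring.
  have : q (k.+1%:R *: e k.+1) x = q (w 0 - w k.+1) x.
    by rewrite accelerated2_e.
  by rewrite /p' /p0 /b !(semi_innerE Hq) eE -[k.+1%:R]natr1; lra.
have {}h := h p'.
have bp : q b b <= q p0 p0.
  apply: le_trans IH; have := p_g_ge0 k; rewrite /b.
  move: (w k - ws) => p; rewrite !(semi_innerE Hq) (semi_innerC Hq (g k)); lra.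
clearbody p' p0 b.
(* Convexity of the squared seminorm, in the form of two nonnegative squares. *)
have h0 := semi_inner_ge0 Hq (p0 - p').
have hb := mulr_ge0 (ler0n R k.+1) (semi_inner_ge0 Hq (b - p')).
move: h0 hb; rewrite !(semi_innerE Hq) !(semi_innerC Hq p') -[k.+1%:R]natr1.
have := ler_wpM2l (ler0n R k.+1) bp; rewrite -[k.+1%:R]natr1 => bp' h0 hb.
rewrite -subr_ge0 -(pmulr_rge0 _ (_ : 0 < k%:R + 2)); last by rewrite ltr_wpDl.
move: bp' h0 hb h; lra.
Qed.

(** Adding [k |g_k|^2 <= 2 <g_k, w_0 - w_k>] and [|g_k|^2 <= 2 <g_k, w_k - ws>] eliminates [w_k];
    Cauchy-Schwarz and division by [|g_k|] finish. *)
Lemma accelerated2_rate k : alpha = 2 ->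
  k.+1%:R * Num.sqrt (q (g k) (g k)) <= 2 * Num.sqrt (q (w 0 - ws) (w 0 - ws)).
Proof.
move=> a2; set G := q (g k) (g k); set p0 := w 0 - ws.
have G0 : 0 <= G by exact: semi_inner_ge0.
case: (eqVneq G 0) => [->|Gn0].
  by rewrite sqrtr0 mulr0 mulr_ge0// sqrtr_ge0.
have sG : 0 < Num.sqrt G by rewrite sqrtr_gt0 lt_neqAle eq_sym Gn0.
rewrite -(ler_pM2r sG) -[leLHS]mulrA -expr2 sqr_sqrtr // -mulrA.
have := semi_inner_le Hq p0 (g k); rewrite -/G => CS.
apply: le_trans (ler_wpM2l _ CS) => //.
have := accelerated_g_le_ge k; have := p_g_ge0 k.
rewrite -(semi_innerZr Hq k%:R (e k)) accelerated2_e // /p0 !(semi_innerE Hq) -/G.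
rewrite !(semi_innerC Hq (g k)) -[k.+1%:R]natr1.
lra.
Qed.

(* [p], [u] and [E] come with their defining equations so that rewriting with
   [semi_innerE] does not unfold them. *)
Lemma accelerated_energy_le (p u : nat -> W) (E : nat -> R) k :
  p = (fun k => w k - ws) -> u = (fun k => k%:R *: e k + (alpha / 2) *: p k) ->
  E = (fun k => q (u k) (u k) + (alpha / 2 - 1) * alpha / 2 * q (p k) (p k)) ->
  E k.+1 + 2 * (alpha / 2 - 1) * (k.+1%:R * q (e k.+1) (e k.+1)) <= E k.
Proof.
move=> pE uE EE.
have pS' := fun x => pS k x pE.
(* The [g k] terms cancel: [u_{k+1} = u_k - (alpha / 2 - 1) e_{k+1}]. *)
have uS x : q (u k) x = q (u k.+1) x + (alpha / 2 - 1) * q (e k.+1) x.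
  have := q_eS k x; rewrite uE !(semi_innerE Hq) pS'.
  rewrite -[k.+1%:R]natr1; lra.
set b := alpha / 2 - 1 in uS EE *; set d := e k.+1 in uS pS' *.
have b0 : 0 <= b by rewrite /b; move: alpha2; lra.
have uu : q (u k) (u k)
    = q (u k.+1) (u k.+1) + 2 * b * q (u k.+1) d + b ^+ 2 * q d d.
  rewrite uS (semi_innerC Hq _ (u k)) (semi_innerC Hq d) !uS.
  by rewrite (semi_innerC Hq d (u _)); ring.
have ud : q (u k.+1) d = k.+1%:R * q d d + alpha / 2 * q (p k.+1) d.
  by rewrite uE !(semi_innerE Hq).
have pp : q (p k) (p k) = q (p k.+1) (p k.+1) - 2 * q (p k.+1) d
    + 2 * q (p k.+1) (g k) + q d d - 2 * q d (g k) + q (g k) (g k).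
  rewrite pS' !(semi_innerC Hq _ (p k)) !pS' (semi_innerC Hq (g k) d).
  by rewrite (semi_innerC Hq d (p _)) (semi_innerC Hq (g k) (p _)); ring.
have pg := pS' (g k).
have dd0 := semi_inner_ge0 Hq d.
(* The energy drop beyond [2 b (k+1) |d|^2] equals [pg0 + bd + bad] exactly; the weight
   [b alpha / 2] of [|p_k|^2] is what makes the terms in [<p_{k+1}, d>] cancel. *)
have pg0 : 0 <= b * alpha * (q (p k) (g k) - 2^-1 * q (g k) (g k)).
  rewrite !mulr_ge0// subr_ge0.
  have := p_g_ge0 k; rewrite pE; lra.
have bd := mulr_ge0 (sqr_ge0 b) dd0.
have bad : 0 <= b * alpha / 2 * q d d by rewrite !mulr_ge0.
rewrite EE uu pp ud; rewrite pg in pg0.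
rewrite -subr_ge0.
apply: le_trans (addr_ge0 (addr_ge0 pg0 bd) bad) _.
rewrite le_eqVlt; apply/orP; left; apply/eqP; by field.
Qed.

(** The initial energy [E 0] serves as both bounds. They carry information only for [alpha > 2],
    since the factor vanishes at [alpha = 2]. *)
Lemma accelerated_energy_bound : exists K : R,
  (forall k, (alpha / 2 - 1) * q (w k - ws) (w k - ws) <= K) /\
  (forall n, (alpha / 2 - 1) * \sum_(0 <= k < n) k%:R * q (e k) (e k) <= K).
Proof.
pose p k := w k - ws; pose u k := k%:R *: e k + (alpha / 2) *: p k.
pose b := alpha / 2 - 1; have b0 : 0 <= b by rewrite /b; move: alpha2; lra.
pose E k := q (u k) (u k) + b * alpha / 2 * q (p k) (p k).
have Estep k : E k.+1 + 2 * b * (k.+1%:R * q (e k.+1) (e k.+1)) <= E k.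
  exact: (@accelerated_energy_le p u).
have sum_le n : E n + 2 * b * \sum_(0 <= k < n.+1) k%:R * q (e k) (e k) <= E 0.
  elim: n => [|n IH]; first by rewrite big_nat1 mul0r mulr0 addr0.
  rewrite big_nat_recr //= mulrDr; have := Estep n; lra.
have pE n : b * q (p n) (p n) <= E n.
  rewrite /E; have := semi_inner_ge0 Hq (u n).
  have := mulr_ge0 b0 (semi_inner_ge0 Hq (p n)) => h1.
  (* Since [alpha / 2 >= 1], the weight [b alpha / 2] in the energy is at least [b]. *)
  have : 0 <= (alpha / 2 - 1) * (b * q (p n) (p n)) by rewrite mulr_ge0//; lra.
  lra.
have s0 n : 0 <= \sum_(0 <= k < n) k%:R * q (e k) (e k).
  by rewrite sumr_ge0 // => i _; rewrite mulr_ge0 ?semi_inner_ge0.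
have E0 n : 0 <= E n.
  by apply: le_trans (pE n); rewrite mulr_ge0 ?semi_inner_ge0.
exists (E 0); split=> n.
  have := mulr_ge0 b0 (s0 n.+1); have := sum_le n; have := pE n; rewrite /p -/b; lra.
case: n => [|n]; first by rewrite big_geq // mulr0.
have := mulr_ge0 b0 (s0 n.+1); have := sum_le n; have := E0 n; rewrite -/b; lra.
Qed.

(** The growth lemma applies to [A k = k^2 |e_k|^2]: the quotients [A k / k] are the summable terms
    [k |e_k|^2], also at [k = 0], where the inverse of 0 is 0. *)
Lemma accelerated_e_cvg0 : 2 < alpha ->
  (fun k => k%:R ^+ 2 * q (e k) (e k)) @ \oo --> (0 : R).
Proof.
move=> a2; have [K [_ HK]] := accelerated_energy_bound.
have b0 : 0 < alpha / 2 - 1 by lra.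
have AE k : k%:R ^+ 2 * q (e k) (e k) / k%:R = k%:R * q (e k) (e k).
  case: k => [|k]; first by rewrite invr0 mulr0 mul0r.
  by rewrite mulrAC expr2 mulfK ?pnatr_eq0.
apply: (@nonneg_slow_growth_cvg0 _ _ (4 * alpha) (K / (alpha / 2 - 1))).
- by move=> k; rewrite mulr_ge0 ?sqr_ge0 ?semi_inner_ge0.
- by rewrite mulr_ge0.
- move=> n; under eq_bigr do rewrite AE.
  by rewrite ler_pdivlMr // mulrC.
move=> k k0; rewrite !AE.
have h : q (g k) (g k) <= 4 * q (e k) (e k).
  have k0' : 0 < k%:R :> R by rewrite ltr0n.
  by rewrite -(ler_pM2l k0') mulrCA accelerated_g_le_e.
(* The recursion reads [k e_k = (k+1) e_{k+1} - D]. Expanding the square and dropping [|D|^2] bounds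
   the increment; [<g_k, e_{k+1}>] is split by Young's inequality, and [k + 1 <= 2 k] leads to the
   constant [4 alpha]. *)
pose D := alpha / 2 *: g k - (alpha - 1) *: e k.+1.
have hx x : q (k%:R *: e k) x = k.+1%:R * q (e k.+1) x - q D x.
  by have := q_eS k x; rewrite /D !(semi_innerE Hq) -[k.+1%:R]natr1; lra.
have A : k%:R ^+ 2 * q (e k) (e k) = k.+1%:R ^+ 2 * q (e k.+1) (e k.+1)
   - 2 * k.+1%:R * (alpha / 2 * q (g k) (e k.+1) - (alpha - 1) * q (e k.+1) (e k.+1))
   + q D D.
  have -> : k%:R ^+ 2 * q (e k) (e k) = q (k%:R *: e k) (k%:R *: e k).
    by rewrite !(semi_innerE Hq) mulrA -expr2.
  rewrite hx !(semi_innerC Hq _ (_ *: e k)) !hx (semi_innerC Hq _ D).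
  have -> : q D (e k.+1)
      = alpha / 2 * q (g k) (e k.+1) - (alpha - 1) * q (e k.+1) (e k.+1).
    by rewrite /D !(semi_innerE Hq).
  ring.
have V0 := semi_inner_ge0 Hq D; rewrite {}A.
have h2 := semi_inner_ge0 Hq (g k - e k.+1).
rewrite !(semi_innerE Hq) (semi_innerC Hq (e k.+1)) in h2.
have ak : 0 <= alpha * k.+1%:R by rewrite mulr_ge0.
have h3 : alpha * k.+1%:R * q (g k) (e k.+1)
   <= alpha * k.+1%:R * (2 * q (e k) (e k) + 2^-1 * q (e k.+1) (e k.+1)).
  by rewrite ler_wpM2l//; lra.
have k1 : k.+1%:R <= 2 * k%:R :> R by rewrite -natrM ler_nat; lia.
have h4 : alpha * q (e k) (e k) * k.+1%:R <= alpha * q (e k) (e k) * (2 * k%:R).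
  by rewrite ler_wpM2l// mulr_ge0 ?semi_inner_ge0.
have h5 : 0 <= (alpha - 1) * (k.+1%:R * q (e k.+1) (e k.+1)).
  by rewrite !mulr_ge0 ?semi_inner_ge0//; lra.
have h6 : 0 <= alpha * k.+1%:R * q (e k.+1) (e k.+1).
  by rewrite mulr_ge0 ?semi_inner_ge0.
lra.
Qed.

End AcceleratedKM.

Lemma accelerated_g_near0 {R : realType} {W : lmodType R} (q : W -> W -> R)
    (Hq : semi_inner q) (alpha : R) (w e g : nat -> W) (ws : W) (eps : R) :
  2 < alpha ->
  (forall k, w k.+1 = w k + e k.+1 - g k) ->
  (forall k, (k%:R + alpha) *: e k.+1 = k%:R *: e k + (alpha / 2) *: g k) ->
  (forall k,
     q (g k.+1 - g k) (g k.+1 - g k) <= 2 * q (g k.+1 - g k) (w k.+1 - w k)) ->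
  (forall k, q (g k) (g k) <= 2 * q (g k) (w k - ws)) -> 0 < eps ->
  \forall k \near \oo, k.+1%:R * Num.sqrt (q (g k) (g k)) <= eps.
Proof.
move=> a2 wS eS gc gs eps0.
(* The 16 is [4 * 4]: one factor from [|g_k|^2 <= 4 |e_k|^2], one from [(k+1)^2 <= 4 k^2]. *)
have d0 : 0 < eps ^+ 2 / 16 by rewrite divr_gt0 ?exprn_gt0.
have /cvgrPdist_lt /(_ _ d0) := accelerated_e_cvg0 Hq (ltW a2) wS eS gc gs a2.
move=> [N _ HN]; exists N.+1 => // k /= Nk.
have k0 : 0 < k%:R :> R by rewrite ltr0n (leq_trans _ Nk).
have /= := HN k (ltnW Nk); rewrite sub0r normrN ger0_norm => [h|]; last first.
  by rewrite mulr_ge0 ?sqr_ge0 ?semi_inner_ge0.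
rewrite -(@ler_pXn2r _ 2) ?nnegrE ?mulr_ge0 ?sqrtr_ge0 ?(ltW eps0)//.
rewrite exprMn sqr_sqrtr ?semi_inner_ge0 //.
have h1 := accelerated_g_le_e Hq (ltW a2) wS eS gc k.
have {}h1 := ler_wpM2l (ltW k0) h1.
have k1 : k.+1%:R ^+ 2 <= 4 * k%:R ^+ 2 :> R.
  have : k.+1%:R <= 2 * k%:R :> R by rewrite -natrM ler_nat; lia.
  have -> : 4 * k%:R ^+ 2 = (2 * k%:R) ^+ 2 :> R by ring.
  by rewrite ler_pXn2r ?nnegrE.
have := ler_wpM2r (semi_inner_ge0 Hq (g k)) k1.
move: h h1; rewrite !mulrA; lra.
Qed.

(** * Accelerated relaxed proximal iterations of a monotone operator *)

Section AcceleratedProximal.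
Context {R : realType} {W : lmodType R} (q : W -> W -> R) (Hq : semi_inner q).
Variables (alpha rho : R) (w wbar what : nat -> W) (ws : W).
Hypotheses (alpha2 : 2 <= alpha) (rho02 : 0 < rho <= 2)
  (whatS : forall k, what k.+1 = (1 - rho) *: w k + rho *: wbar k)
  (wS : forall k, w k.+1 = w k
     + (alpha / (2 * (k%:R + alpha))) *: (what k.+1 - w k)
     + (k%:R / (k%:R + alpha)) *: (what k.+1 - what k))
  (mono : forall j k,
     0 <= q ((w j - wbar j) - (w k - wbar k)) (wbar j - wbar k))
  (mono_sol : forall k, 0 <= q (w k - wbar k) (wbar k - ws)).

Let e k := w k - what k.
Let g k := rho *: (w k - wbar k).

Let whatSg k : what k.+1 = w k - g k.
Proof. by rewrite whatS /g scalerBl scale1r scalerBr opprB addrA addrAC. Qed.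

Let wSe k : w k.+1 = w k + e k.+1 - g k.
Proof. by rewrite /e whatSg opprB [w k + _]addrC addrA subrK addrK. Qed.

Let eS k : (k%:R + alpha) *: e k.+1 = k%:R *: e k + (alpha / 2) *: g k.
Proof.
have ka : k%:R + alpha != 0.
  by rewrite gt_eqF// ltr_wpDl// (lt_le_trans _ alpha2).
set a := alpha / (2 * (k%:R + alpha)); set b := k%:R / (k%:R + alpha).
(* This relation between the two extrapolation coefficients leaves [a] as the coefficient of [g k]
   in [e k.+1]. *)
have ab : 1 - b = a + a by rewrite /a /b; field.
have -> : e k.+1 = b *: e k + a *: g k.
  rewrite /e wS -/a -/b !whatSg; move: (g k) => G.
  have -> : a *: G = G - b *: G - a *: G.
    by rewrite -[in X in X - _ - _](scale1r G) -!scalerBl ab addrK.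
  have -> : w k - G - w k = - G by rewrite addrAC subrr add0r.
  have -> : w k - G - what k = e k - G by rewrite addrAC.
  rewrite scalerN scalerBr -/(e k) opprB.
  move: (e k) => E; rewrite [LHS]addrC -!addrA [RHS]addrCA addKr; congr (_ + _).
  by rewrite addrC -addrA.
rewrite scalerDr !scalerA; congr (_ *: _ + _ *: _); rewrite /a /b; by field.
Qed.

(** With [d] and [v] the increments of [w - wbar] and [wbar], monotonicity is [<d, v> >= 0]. Hence
    [|rho d|^2 <= 2 rho |d|^2 <= 2 <rho d, d + v>], where [rho <= 2] enters. *)
Let g_cocoercive k :
  q (g k.+1 - g k) (g k.+1 - g k) <= 2 * q (g k.+1 - g k) (w k.+1 - w k).
Proof.
have := mono k.+1 k; rewrite /g -scalerBr.
have h x : q x (w k.+1 - w k) = q x (w k.+1 - wbar k.+1 - (w k - wbar k))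
    + q x (wbar k.+1 - wbar k) by rewrite !(semi_innerE Hq); ring.
rewrite !(semi_innerZl Hq) (semi_innerZr Hq) h.
move: (w k.+1 - wbar k.+1 - _) (wbar k.+1 - _) => d v dv.
have dd := semi_inner_ge0 Hq d; case/andP: rho02 => r0 r2.
have h1 := mulr_ge0 (ltW r0) dv.
have : 0 <= (2 - rho) * (rho * q d d) by rewrite !mulr_ge0 ?(ltW r0)// subr_ge0.
lra.
Qed.

Let g_cocoercive_sol k : q (g k) (g k) <= 2 * q (g k) (w k - ws).
Proof.
have := mono_sol k; rewrite /g.
set d := w k - wbar k.
have -> : wbar k - ws = (w k - ws) - d by rewrite /d opprB [RHS]addrC addrA subrK.
clearbody d; rewrite !(semi_innerE Hq) => h.
have := semi_inner_ge0 Hq d; move: rho02 => /andP[r0 r2] dd.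
have h1 := mulr_ge0 (ltW r0) h.
have : 0 <= (2 - rho) * (rho * q d d) by rewrite !mulr_ge0 ?(ltW r0)// subr_ge0.
lra.
Qed.

Let D k := Num.sqrt (q (w k - wbar k) (w k - wbar k)).

Let DE k : Num.sqrt (q (g k) (g k)) = rho * D k.
Proof.
have r0 : 0 <= rho by case/andP: rho02 => /ltW.
rewrite /g (semi_innerZl Hq) (semi_innerZr Hq) mulrA -expr2 sqrtrM ?sqr_ge0//.
by rewrite sqrtr_sqr ger0_norm.
Qed.

Let dist_wbar k : q (wbar k - ws) (wbar k - ws) <= q (w k - ws) (w k - ws).
Proof.
have := mono_sol k.
have -> : w k - ws = (w k - wbar k) + (wbar k - ws) by rewrite addrA subrK.
move: (w k - wbar k) (wbar k - ws) => d p h; rewrite !(semi_innerE Hq).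
rewrite (semi_innerC Hq p d); have := semi_inner_ge0 Hq d; lra.
Qed.

Lemma accelerated2_proximal_rate k : alpha = 2 ->
  D k <= 2 * Num.sqrt (q (w 0 - ws) (w 0 - ws)) / (rho * k.+1%:R).
Proof.
move=> a2; have r0 : 0 < rho by case/andP: rho02.
rewrite ler_pdivlMr ?mulr_gt0// mulrA (mulrC _ rho) -DE mulrC.
exact: (accelerated2_rate Hq alpha2 wSe eS g_cocoercive g_cocoercive_sol).
Qed.

Lemma accelerated2_proximal_dist k : alpha = 2 ->
  Num.sqrt (q (wbar k - ws) (wbar k - ws)) <= Num.sqrt (q (w 0 - ws) (w 0 - ws)).
Proof.
move=> a2; apply: ler_wsqrtr; apply: le_trans (dist_wbar k) _.
exact: (accelerated2_dist Hq wSe eS g_cocoercive_sol).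
Qed.

Lemma accelerated_proximal_rate (eps : R) : 2 < alpha -> 0 < eps ->
  \forall k \near \oo, k.+1%:R * D k <= eps.
Proof.
move=> a2 eps0; have r0 : 0 < rho by case/andP: rho02.
have : \forall k \near \oo, k.+1%:R * Num.sqrt (q (g k) (g k)) <= rho * eps.
  apply: (accelerated_g_near0 Hq a2 wSe eS g_cocoercive g_cocoercive_sol).
  by rewrite mulr_gt0.
by apply: filterS => k; rewrite DE mulrCA ler_pM2l.
Qed.

Lemma accelerated_proximal_dist : 2 < alpha -> exists2 K : R, 0 <= K &
  forall k, Num.sqrt (q (wbar k - ws) (wbar k - ws)) <= K.
Proof.
move=> a2.
have [K [HK _]] : exists K : R,
  (forall k, (alpha / 2 - 1) * q (w k - ws) (w k - ws) <= K) /\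
  (forall n, (alpha / 2 - 1) * \sum_(0 <= k < n) k%:R * q (e k) (e k) <= K).
  exact: (accelerated_energy_bound Hq alpha2 wSe eS g_cocoercive_sol).
have b0 : 0 < alpha / 2 - 1 by lra.
exists (Num.sqrt (K / (alpha / 2 - 1))); first exact: sqrtr_ge0.
move=> k; apply: ler_wsqrtr; apply: le_trans (dist_wbar k) _.
by rewrite ler_pdivlMr // mulrC.
Qed.

End AcceleratedProximal.

(** * Finite-dimensional Euclidean spaces *)

Section EuclideanSpace.
Context {R : realType}.
Implicit Types (U V : euclideanType R).

Lemma dot_semi_inner V : semi_inner (@dot R V).
Proof.
split; [exact: dotC | exact: dot_linearl | move=> u].
by rewrite -sqr_normE sqr_ge0.
Qed.

Definition dotE V := semi_innerE (dot_semi_inner V).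

Lemma sqrt_dot V (u : V) : Num.sqrt (dot u u) = `|u|.
Proof. by rewrite -sqr_normE sqrtr_sqr normr_id. Qed.

Lemma dot_CauchySchwarz V (u v : V) : `|dot u v| <= `|u| * `|v|.
Proof.
by rewrite -(sqrt_dot u) -(sqrt_dot v) (semi_inner_CauchySchwarz (dot_semi_inner V)).
Qed.

Lemma dot_le V (u v : V) : dot u v <= `|u| * `|v|.
Proof. exact: le_trans (ler_norm _) (dot_CauchySchwarz u v). Qed.

Lemma dot_sumr V n (u : V) (F : 'I_n -> V) :
  dot u (\sum_i F i) = \sum_i dot u (F i).
Proof.
elim/big_rec2: _ => [|i x y _ <-]; last by rewrite (dotE V).
by rewrite dotC (semi_inner0l (dot_semi_inner V)).
Qed.

(* The Gram matrix of a basis is invertible, so coordinates are combinations of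
   inner products with the basis vectors. *)
Lemma coord_bounded V : exists2 K : R, 0 <= K &
  forall u : V, forall i, `|coord (vbasis {:V}) i u| <= K * `|u|.
Proof.
set e := vbasis {:V}.
pose G := \matrix_(i, j) dot e`_i e`_j : 'M[R]_(\dim {:V}).
have uE u : u = \sum_i coord e i u *: e`_i by rewrite -coord_vbasis ?memvf.
(* A row in the kernel of [G] gives a vector orthogonal to the whole basis, hence zero; freeness
   then kills its coefficients. *)
have Gu : G \in unitmx.
  rewrite -row_free_unit -kermx_eq0; apply/eqP/row_matrixP => r.
  rewrite row0; set x := row r _.
  have xG : x *m G = 0 by apply: sub_kermxP; rewrite row_sub.
  pose u := \sum_i x 0 i *: e`_i.
  have ue (j : 'I_(\dim {:V})) : dot u e`_j = 0.
    rewrite dotC /u dot_sumr.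
    transitivity ((x *m G) 0 j); last by rewrite xG mxE.
    rewrite mxE; apply: eq_bigr => i _.
    by rewrite (dotE V) [G i j]mxE (dotC e`_j).
  have u0 : u = 0.
    apply/eqP; rewrite -normr_eq0 -sqrf_eq0 sqr_normE {2}/u dot_sumr big1 // => i _.
    by rewrite (dotE V) ue mulr0.
  apply/rowP => i; rewrite [RHS]mxE.
  have /freeP := basis_free (vbasisP {:V}).
  by move=> /(_ (fun i => x 0 i)); apply.
pose K := \sum_(i < \dim {:V}) \sum_(j < \dim {:V}) `|e`_j| * `|invmx G j i|.
exists K.
  by rewrite sumr_ge0// => i _; rewrite sumr_ge0// => j _; rewrite mulr_ge0.
move=> u i.
have -> : coord e i u = \sum_(j < \dim {:V}) dot u e`_j * invmx G j i.
  have : (\row_i coord e i u) *m G = \row_(j < \dim {:V}) dot u e`_j.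
    apply/rowP => j; rewrite !mxE dotC [in RHS](uE u) dot_sumr.
    by apply: eq_bigr => k _; rewrite !mxE (dotE V) dotC.
  move/(congr1 (mulmx^~ (invmx G))); rewrite mulmxK // => /rowP /(_ i).
  by rewrite !mxE => ->; apply: eq_bigr => j _; rewrite mxE.
apply: le_trans (ler_norm_sum _ _ _) _.
rewrite /K [X in _ <= X * _](bigD1 i) //= mulrDl -[leLHS]addr0 lerD //; last first.
  by rewrite mulr_ge0 ?sumr_ge0// => k _; rewrite sumr_ge0// => j _; rewrite mulr_ge0.
rewrite mulr_suml; apply: ler_sum => j _; rewrite normrM mulrAC ler_wpM2r //.
by rewrite mulrC dot_CauchySchwarz.
Qed.

(** Bounds the set in [opnorm], so that its [sup] is a genuine supremum. *)
Lemma hom_bounded U V (A : 'Hom(U, V)) :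
  exists2 K : R, 0 <= K & forall u, `|A u| <= K * `|u|.
Proof.
have [K K0 HK] := coord_bounded U.
exists (\sum_(i < \dim {:U}) K * `|A (vbasis {:U})`_i|).
  by rewrite sumr_ge0 // => i _; rewrite mulr_ge0.
move=> u; rewrite {1}(coord_vbasis (memvf u)) linear_sum mulr_suml.
apply: le_trans (ler_norm_sum _ _ _) _; apply: ler_sum => i _.
by rewrite linearZ normrZ mulrAC ler_wpM2r.
Qed.

Lemma le_opnorm U V (A : 'Hom(U, V)) u : `|A u| <= opnorm A * `|u|.
Proof.
have [K K0 HK] := hom_bounded A.
case: (eqVneq u 0) => [->|u0]; first by rewrite linear0 !normr0 mulr0.
have nu : 0 < `|u| by rewrite normr_gt0.
rewrite -ler_pdivrMr //; apply: ub_le_sup.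
  exists K => _ [v /= v1 <-]; apply: le_trans (HK v) _.
  by rewrite ler_piMr.
exists (`|u|^-1 *: u) => /=; first by rewrite normrZ normfV normr_id mulVf ?gt_eqF.
by rewrite linearZ normrZ normfV normr_id mulrC.
Qed.

Lemma opnorm_ge0 U V (A : 'Hom(U, V)) : 0 <= opnorm A.
Proof.
have [K K0 HK] := hom_bounded A.
apply: ub_le_sup; last by exists 0; rewrite /= ?linear0 normr0.
by exists K => _ [v /= v1 <-]; apply: le_trans (HK v) _; rewrite ler_piMr.
Qed.

Lemma hom_continuous U V (A : 'Hom(U, V)) : continuous A.
Proof.
have [K K0 HK] := hom_bounded A.
move=> u; apply/cvgrPdist_le => eps eps0.
have d0 : 0 < eps / (K + 1) by rewrite divr_gt0 // ltr_wpDl.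
near=> v; rewrite -linearB; apply: le_trans (HK _) _.
have : `|u - v| <= eps / (K + 1) by near: v; exact: cvgr_dist_le.
rewrite ler_pdivlMr ?ltr_wpDl //.
have := normr_ge0 (u - v); lra.
Unshelve. all: by end_near.
Qed.

Lemma lte_EFin_dense (a : R) (x : \bar R) :
  (a%:E < x)%E -> exists2 b : R, a < b & (b%:E < x)%E.
Proof.
case: x => [r||] //; first rewrite lte_fin => ar.
  by exists ((a + r) / 2); rewrite ?lte_fin; lra.
by exists (a + 1); rewrite ?ltry //; lra.
Qed.

(* A cluster point of a minimizing sequence, taken in coordinates, is a
   minimizer. *)
Lemma lsc_coercive_argmin V (f : V -> \bar R) (m B : R) (v0 : V) :
  lower_semicontinuous f -> (f v0 < +oo)%E -> (forall u, (m%:E <= f u)%E) ->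
  (forall u, (f u <= f v0 + 1)%E -> `|u| <= B) ->
  exists p, forall u, (f p <= f u)%E.
Proof.
move=> lf f0 fm fB.
pose S := [set r : R | exists u, (f u <= r%:E)%E].
have fin u : (f u < +oo)%E -> f u \is a fin_num.
  by move=> fu; rewrite fin_numElt fu andbT (lt_le_trans (ltNyr m)).
have Sf u : (f u < +oo)%E -> S (fine (f u)).
  by move=> fu; exists u; rewrite fineK // fin.
have Sinf : has_inf S.
  split; first by exists (fine (f v0)); exact: Sf.
  by exists m => r [u fur]; rewrite -lee_fin (le_trans (fm u)).
have Sle u : (f u < +oo)%E -> inf S <= fine (f u).
  by move=> fu; apply: ge_inf; [case: Sinf | exact: Sf].
(* A minimizing sequence; its excess [1/(k+1)] is at most 1, which matches the sublevel [f v0 + 1]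
   of the coercivity hypothesis. *)
have /choice[x Hx] (k : nat) : exists u, (f u <= (inf S + k.+1%:R^-1)%:E)%E.
  have k0 : 0 < k.+1%:R^-1 :> R by rewrite invr_gt0.
  have [r [u fur] rS] := inf_adherent k0 Sinf.
  by exists u; rewrite (le_trans fur) // lee_fin ltW.
have xB k : `|x k| <= B.
  apply: fB; apply: le_trans (Hx k) _.
  rewrite -(fineK (fin _ f0)) -EFinD lee_fin lerD ?Sle //.
  by rewrite invf_le1 // ler1n.
have [K K0 HK] := coord_bounded V.
set e := vbasis {:V} in HK; set n := \dim {:V} in e HK.
pose L (c : 'rV[R]_n) : V := \sum_i c ord0 i *: e`_i.
pose y k : 'rV[R]_n := \row_i coord e i (x k).
have Ly k : L (y k) = x k.
  rewrite [RHS](coord_vbasis (memvf (x k))); apply: eq_bigr => i _.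
  by rewrite mxE.
have Lcont : continuous L.
  apply: continuous_big => [z|i _ c]; first exact: add_continuous.
  have h := @coord_continuous R 1 n ord0 i c.
  exact: (@cvgZr_tmp _ _ _ _ _ (fun x : 'rV[R]_n => x ord0 i) (c ord0 i) e`_i h).

have Cy := @rV_compact _ n (fun=> `[- (K * B), K * B]%classic)
  (fun=> @segment_compact _ _ _).
have [|c [_ cc]] := Cy (y @ \oo) _.
  exists 0%N => // k _ i /=; rewrite in_itv /= -ler_norml /y mxE.
  by apply: le_trans (HK _ _) _; rewrite ler_wpM2l.
exists (L c) => u.
have [fu|] := ltP (f u) +oo%E; last first.
  by rewrite leye_eq => /eqP ->; rewrite leey.
rewrite leNgt; apply/negP => fuL.
(* Lower semicontinuity keeps [f] above [a] near the cluster point [L c], whereas the sequence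
   returns there with values below [a]. *)
have [a Sa af] : exists2 a : R, inf S < a & (a%:E < f (L c))%E.
  apply: lte_EFin_dense; apply: le_lt_trans fuL.
  by rewrite -(fineK (fin _ fu)) lee_fin Sle.
have [N LN aN] := lf _ _ af.
have aS : 0 < a - inf S by rewrite subr_gt0.
have [M _ HM] := near_infty_natSinv_lt (PosNum aS).
have yM : (y @ \oo) [set y k | k in [set k | (M <= k)%N]].
  by exists M => // k Mk; exists k.
have [_ [[k Mk <-] /= Nk]] := cc _ _ yM (Lcont _ _ LN).
have := aN _ Nk; rewrite Ly ltNge => /negP; apply.
apply: le_trans (Hx k) _; rewrite lee_fin -lerBrDl ltW //.
exact: HM.
Unshelve. all: by end_near.
Qed.

End EuclideanSpace.

(** * Subdifferential and proximal mapping *)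

Section Convex.
Context {R : realType} {V : euclideanType R}.
Implicit Types (f : V -> \bar R).

Let dE := dotE V.

(** Polarization reduces the claim to continuity of the norm. *)
Lemma cvg_dot (a b : nat -> V) (a' b' : V) :
  a @ \oo --> a' -> b @ \oo --> b' -> dot (a k) (b k) @[k --> \oo] --> dot a' b'.
Proof.
have dotP (x y : V) : dot x y = 4^-1 * (`|x + y| ^+ 2 - `|x - y| ^+ 2).
  by rewrite !sqr_normE !dE (semi_innerC (dot_semi_inner V) y); field.
move=> ca cb; rewrite dotP; under eq_cvg do rewrite dotP.
apply: cvgM; first exact: cvg_cst.
rewrite !expr2; under eq_cvg do rewrite !expr2.
by apply: cvgB; apply: cvgM; apply: cvg_norm; (exact: cvgB || exact: cvgD).
Qed.

Lemma subdiff_fin_num f v phi :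
  proper_fun f -> subdiff f v phi -> f v \is a fin_num.
Proof.
move=> [fN [u fu]] /(_ u) /= h; rewrite fin_numE fN /=.
apply/eqP => fv; move: h; rewrite fv addye // leye_eq => /eqP fuy.
by move: fu; rewrite /edom /= fuy ltxx.
Qed.

Lemma subdiff_monotone f v v' phi phi' : proper_fun f ->
  subdiff f v phi -> subdiff f v' phi' -> 0 <= dot (phi - phi') (v - v').
Proof.
move=> fp h h'; have fv := subdiff_fin_num fp h; have fv' := subdiff_fin_num fp h'.
have := h v'; have := h' v; rewrite /= -(fineK fv) -(fineK fv') -!EFinD !lee_fin.
rewrite !dE; lra.
Qed.

(* First-order optimality: compare [v] with [v + t (u - v)] as [t > 0] tends
   to [0]. *)
Lemma argmin_subdiff f (q : V -> R) v phi :
  proper_fun f -> econvex f ->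
  is_argmin (fun u => f u + (q u)%:E)%E v ->
  (forall u, exists K, forall t, 0 < t < 1 ->
     q (t *: u + (1 - t) *: v) <= q v - t * dot phi (u - v) + t ^+ 2 * K) ->
  subdiff f v phi.
Proof.
move=> [fN [u0 fu0]] fc vmin Hq.
have fv : f v \is a fin_num.
  rewrite fin_numE fN /=; apply/eqP => fv; have := vmin u0.
  rewrite fv addye // leye_eq => /eqP h; move: fu0; rewrite /edom /=.
  by case: (f u0) h (fN u0).
move=> u /=.
have [fu|] := ltP (f u) +oo%E; last by rewrite leye_eq => /eqP ->; rewrite leey.
have {}fu : f u \is a fin_num by rewrite fin_numE fN lt_eqF.
have [K HK] := Hq u.
have key t : 0 < t < 1 -> fine (f v) + dot phi (u - v) <= fine (f u) + t * K.
  move=> t01; have /andP[t0 t1] := t01.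
  have := le_trans (vmin _) (leeD (fc u v t t01)
    (_ : (_ <= (q v - t * dot phi (u - v) + t ^+ 2 * K)%:E)%E)).
  rewrite lee_fin => /(_ (HK t t01)).
  rewrite -(fineK fv) -(fineK fu) -!EFinM -!EFinD lee_fin => h.
  rewrite -(ler_pM2l t0); lra.
rewrite -(fineK fv) -(fineK fu) -EFinD lee_fin.
apply/ler_addgt0Pr => eps eps0.
(* Small enough that [t < 1] and [t K <= eps]; the added 1 keeps the denominator positive. *)
pose t := Num.min (1 / 2) (eps / (`|K| + 1)).
have K1 : 0 < `|K| + 1 by rewrite ltr_wpDl.
have t0 : 0 < t by rewrite lt_min !divr_gt0.
have t1 : t < 1 by rewrite gt_min; apply/orP; left; lra.
apply: le_trans (key t _) _; rewrite ?t0 // lerD2l.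
apply: le_trans (_ : t * (`|K| + 1) <= _).
  by rewrite ler_pM2l //; have := ler_norm K; lra.
by rewrite -ler_pdivlMr // ge_min lexx orbT.
Qed.

Lemma argmin_prox_subdiff f v p :
  proper_fun f -> econvex f ->
  is_argmin (fun u => f u + (2^-1 * `|u - v| ^+ 2)%:E)%E p -> subdiff f p (v - p).
Proof.
move=> fp fc pmin; apply: (argmin_subdiff fp fc pmin) => u.
exists (2^-1 * dot (u - p) (u - p)) => t _; rewrite !sqr_normE.
have -> : t *: u + (1 - t) *: p - v = (p - v) + t *: (u - p).
  rewrite scalerBl scale1r scalerBr addrA [t *: u + p]addrC -!addrA.
  by congr (_ + _); rewrite addrA [RHS]addrC.
have -> : v - p = - (p - v) by rewrite opprB.
move: (p - v) (u - p) => a b; rewrite !dE (semi_innerC (dot_semi_inner V) b a); lra.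
Qed.

Lemma lsc_addr_continuous f (q : V -> R) :
  lower_semicontinuous f -> continuous q ->
  lower_semicontinuous (fun u => f u + (q u)%:E)%E.
Proof.
move=> lf cq x a; rewrite -lteBlDr // -EFinB => h.
have [b ab bf] := lte_EFin_dense h.
have [N Nx HN] := lf x b bf.
have eps0 : 0 < b - (a - q x) by rewrite subr_gt0.
exists (N `&` [set y | `|q x - q y| < b - (a - q x)]).
  by apply: filterI => //; have /cvgrPdist_lt := cq x; exact.
move=> y [Ny /= qy]; rewrite -lteBlDr // -EFinB.
apply: le_lt_trans (HN _ Ny); rewrite lee_fin.
have := ler_norm (q x - q y); lra.
Qed.

(* The subgradient gives an affine minorant, which makes the prox objective
   coercive. *)
Lemma prox_subdiff f v0 phi v : proper_closed_convex f -> subdiff f v0 phi ->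
  subdiff f (prox f v) (v - prox f v).
Proof.
move=> [fp fl fc] hphi; apply: argmin_prox_subdiff => //.
suff [p hp] : exists p, is_argmin (fun u => f u + (2^-1 * `|u - v| ^+ 2)%:E)%E p.
  exact: (@getPex _ [set p | is_argmin
    (fun u => f u + (2^-1 * `|u - v| ^+ 2)%:E)%E p] (ex_intro _ p hp)).
have fv := subdiff_fin_num fp hphi.
set F := fun u => (f u + _)%E.
have lF : lower_semicontinuous F.
  apply: (lsc_addr_continuous fl) => u; apply: cvgM; first exact: cvg_cst.
  under eq_cvg do rewrite expr2.
  by rewrite expr2; apply: cvgM; apply: cvg_norm; apply: cvgB => //; exact: cvg_cst.
pose G u := fine (f v0) + dot phi (u - v0) + 2^-1 * `|u - v| ^+ 2.
have GF u : ((G u)%:E <= F u)%E.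
  by rewrite /F /G EFinD leeD2r // EFinD fineK //; exact: hphi.
(* Completing the square: the minorant is a constant plus half the squared distance to [v - phi]. *)
have GE u : G u = fine (f v0) + dot phi (v - v0) - 2^-1 * `|phi| ^+ 2
     + 2^-1 * `|u - (v - phi)| ^+ 2.
  rewrite /G !sqr_normE.
  have -> : u - v0 = (u - v) + (v - v0) by rewrite addrA subrK.
  have -> : u - (v - phi) = (u - v) + phi by rewrite opprB addrA addrAC.
  move: (u - v) (v - v0) => a b; rewrite !dE (semi_innerC (dot_semi_inner V) a phi); lra.
pose M := fine (F v0) + 1 - (fine (f v0) + dot phi (v - v0) - 2^-1 * `|phi| ^+ 2).
apply: (@lsc_coercive_argmin _ _ F (fine (f v0) + dot phi (v - v0) - 2^-1 * `|phi| ^+ 2)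
  (`|v - phi| + (2 * M + 1)) v0) => //.
- by rewrite /F -(fineK fv) -EFinD ltry.
- by move=> u; apply: le_trans (GF u); rewrite lee_fin GE lerDl mulr_ge0.
move=> u Fu.
have FE : F v0 = (fine (F v0))%:E by rewrite fineK // /F -(fineK fv).
have := le_trans (GF u) Fu; rewrite FE -EFinD lee_fin GE => h.
(* From [x^2 <= 2 M] and [2 x <= x^2 + 1], which avoids a square root. *)
have h2 : `|u - (v - phi)| <= 2 * M + 1.
  move: h; rewrite /M; move: `|u - (v - phi)| => x h.
  have := sqr_ge0 (x - 1); have := sqr_ge0 x; rewrite sqrrB1 -mulr_natr; lra.
by rewrite -[u](subrK (v - phi)) addrC (le_trans (ler_normD _ _)) // lerD2l.
Qed.

(** As [v] is the prox of [v + phi], this is nonexpansiveness of the prox between [v + p] and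
    [v + phi], obtained from monotonicity of the subdifferential and Cauchy-Schwarz. *)
Lemma prox_residual_le f v phi p : proper_closed_convex f ->
  subdiff f v phi -> `|v - prox f (v + p)| <= `|p - phi|.
Proof.
move=> fpcc hv; have hp := prox_subdiff (v + p) fpcc hv.
set P := prox f _ in hp *; have [fp _ _] := fpcc.
have := subdiff_monotone fp hv hp.
have -> : phi - (v + p - P) = (phi - p) - (v - P).
  by rewrite !opprD !opprK !addrA; congr (_ + _); rewrite addrAC.
rewrite (distrC p); move: (phi - p) (v - P) => a b.
rewrite (semi_innerDl (dot_semi_inner V)) (semi_innerNl (dot_semi_inner V)).
rewrite -sqr_normE subr_ge0 => /le_trans /(_ (dot_le _ _)) h.
have [->|b0] := eqVneq `|b| 0; first exact: normr_ge0.
by rewrite -(@ler_pM2r _ `|b|) ?lt_def ?b0 //= -expr2.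
Qed.

(** Closedness of the graph. If the limit inequality failed, a value [a] strictly in between would
    bound [f (v k)] from below for large [k], against the subgradient inequality at [v k]. *)
Lemma subdiff_cvg f (v phi : nat -> V) v' phi' :
  proper_fun f -> lower_semicontinuous f ->
  (forall k, subdiff f (v k) (phi k)) ->
  v @ \oo --> v' -> phi @ \oo --> phi' -> subdiff f v' phi'.
Proof.
move=> [fN _] lf hk cv cphi u /=.
have [fu|] := ltP (f u) +oo%E; last by rewrite leye_eq => /eqP ->; rewrite leey.
have {}fu : f u \is a fin_num by rewrite fin_numE fN lt_eqF.
rewrite -(fineK fu) -leeBrDr // -EFinB leNgt; apply/negP => h.
have [a ha af] := lte_EFin_dense h.
have [N Nv HN] := lf _ _ af.
have cdot : dot (phi k) (u - v k) @[k --> \oo] --> dot phi' (u - v').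
  exact: cvg_dot cphi (cvgB (cvg_cst _) cv).
have d0 : 0 < a - (fine (f u) - dot phi' (u - v')) by rewrite subr_gt0.
have /cvgrPdist_lt /(_ _ d0) [M1 _ HM1] := cdot.
have [M2 _ HM2] := cv _ Nv.
pose k := maxn M1 M2.
have h1 := HM1 k (leq_maxl _ _).
have h2 := HN _ (HM2 k (leq_maxr _ _)).
have := hk k u; rewrite /= -(fineK fu) -leeBrDr // -EFinB => h3.
have := lt_le_trans h2 h3; rewrite lte_fin.
have := ler_norm (dot phi' (u - v') - dot (phi k) (u - v k)).
move: h1 => /=; lra.
Qed.

End Convex.

(** * The KKT operator *)

(** Reduces vector identities to scalar ones, within reach of [ring] and [field]. *)
Lemma dot_ext {R : realType} {V : euclideanType R} (a b : V) :
  (forall u, dot a u = dot b u) -> a = b.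
Proof.
move=> h; apply/eqP; rewrite -subr_eq0 -normr_eq0 -sqrf_eq0 sqr_normE.
rewrite (semi_innerDl (dot_semi_inner V)) (semi_innerNl (dot_semi_inner V)).
by rewrite h subrr.
Qed.

Lemma seminorm_op_sqr {R : realType} {V : euclideanType R} (S : 'End(V)) v :
  psd_op S -> seminorm_op S v ^+ 2 = dot v (S v).
Proof. by move=> [_ h]; rewrite sqr_sqrtr. Qed.

(** Covers both minimization steps: [a] collects the part of the constraint fixed during the step,
    [b] the fixed part of the objective. *)
Lemma argmin_augLag_subdiff {R : realType} {V X : euclideanType R}
    (f : V -> \bar R) (B : 'Hom(V, X)) (Bs : 'Hom(X, V)) (T : 'End(V))
    (x a : X) (v0 v : V) (sigma b : R) :
  proper_fun f -> econvex f -> is_adjoint B Bs -> psd_op T ->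
  is_argmin (fun u => f u + (b + (dot x (B u + a) + sigma / 2 * `|B u + a| ^+ 2)
     + 2^-1 * seminorm_op T (u - v0) ^+ 2)%:E)%E v ->
  subdiff f v (T (v0 - v) - Bs (x + sigma *: (B v + a))).
Proof.
move=> fp fc BBs Tp vmin; apply: (argmin_subdiff fp fc vmin) => u.
exists (sigma / 2 * `|B (u - v)| ^+ 2 + 2^-1 * dot (u - v) (T (u - v))) => t _.
have -> : t *: u + (1 - t) *: v = v + t *: (u - v).
  by rewrite scalerBl scale1r scalerBr addrCA.
rewrite !seminorm_op_sqr // !sqr_normE.
have -> : B (v + t *: (u - v)) + a = (B v + a) + t *: B (u - v).
  by rewrite linearD linearZ addrAC.
have -> : v + t *: (u - v) - v0 = (v - v0) + t *: (u - v) by rewrite addrAC.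
have -> : T (v0 - v) = - T (v - v0) by rewrite -linearN opprB.
have [Ts _] := Tp.
move: (B v + a) (u - v) (v - v0) => p d e.
rewrite linearD linearZ !(dotE V) !(dotE X).
rewrite (dotC (Bs _)) -BBs !(dotE X) (Ts e d) (dotC (B d) p).
rewrite (dotC (B d) x) (dotC d (T e)) -(Ts e d) (dotC (T e)); lra.
Qed.

Section KKTOperator.
Context {R : realType} {X Y Z : euclideanType R}.
Local Notation W := (Y * Z * X)%type.
Variables (f1 : Y -> \bar R) (f2 : Z -> \bar R).
Variables (B1 : 'Hom(Y, X)) (B2 : 'Hom(Z, X)).
Variables (B1s : 'Hom(X, Y)) (B2s : 'Hom(X, Z)) (c : X).
Variables (T1 : 'End(Y)) (T2 : 'End(Z)) (sigma : R).
Hypotheses (hf1 : proper_closed_convex f1) (hf2 : proper_closed_convex f2)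
  (hB1s : is_adjoint B1 B1s) (hB2s : is_adjoint B2 B2s)
  (hT1 : psd_op T1) (hT2 : psd_op T2) (hsigma : 0 < sigma).

Local Notation M := (opM B1 B1s T1 T2 sigma).
Local Notation normMs := (normM B1 B1s T1 T2 sigma).

Let hp1 : proper_fun f1. Proof. by case: hf1. Qed.
Let hp2 : proper_fun f2. Proof. by case: hf2. Qed.
Let hc1 : econvex f1. Proof. by case: hf1. Qed.
Let hc2 : econvex f2. Proof. by case: hf2. Qed.
Let dE := (dotE X, dotE Y, dotE Z).

Definition dotM (u v : W) := dotW u (M v).

(** The graph of the KKT operator [T], that is [v \in T w]. The sign of the third component makes
    the linear part of [T] skew. *)
Definition KKTop (w v : W) : Prop :=
  [/\ subdiff f1 (yc w) (yc v - B1s (xc w)),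
      subdiff f2 (zc w) (zc v - B2s (xc w)) &
      xc v = c - B1 (yc w) - B2 (zc w)].

Lemma KKTop0 w : KKT f1 f2 B1 B2 B1s B2s c w <-> KKTop w 0.
Proof.
split=> [] [h1 h2 h3]; split; rewrite ?sub0r // in h1 h2 *.
  by rewrite -addrA -opprD -[LHS]oppr0 -h3 opprB.
by apply/eqP; rewrite -oppr_eq0 opprB opprD addrA; apply/eqP; rewrite -h3.
Qed.

Lemma dotWC (u v : W) : dotW u v = dotW v u.
Proof. by rewrite /dotW (dotC (yc u)) (dotC (zc u)) (dotC (xc u)). Qed.

(** The skew linear part cancels, leaving monotonicity of the two subdifferentials. *)
Lemma KKTop_monotone w v w' v' :
  KKTop w v -> KKTop w' v' -> 0 <= dotW (v - v') (w - w').
Proof.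
move=> [h1 h2 h3] [h1' h2' h3'].
have := subdiff_monotone hp1 h1 h1'; have := subdiff_monotone hp2 h2 h2'.
rewrite /dotW.
have -> : xc (v - v') = - B1 (yc (w - w')) - B2 (zc (w - w')).
  have -> : xc (v - v') = xc v - xc v' by [].
  rewrite h3 h3' !linearB /=; apply: dot_ext => u; rewrite !dE; ring.
have -> : yc (v - v') = yc v - yc v' by [].
have -> : zc (v - v') = zc v - zc v' by [].
have -> : xc (w - w') = xc w - xc w' by [].
rewrite -[yc w - yc w']/(yc (w - w')) -[zc w - zc w']/(zc (w - w')).
move: (yc (w - w')) (zc (w - w')) => y z.
rewrite !dE !(dotC (B1s _)) !(dotC (B2s _)) -!hB1s -!hB2s; lra.
Qed.

Lemma pADMM_step_KKTop (w wbar : W) :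
  is_argmin (fun z => augLag B1 B2 c sigma (cst 0%E) f2 (yc w) z (xc w)
        + (2^-1 * seminorm_op T2 (z - zc w) ^+ 2)%:E)%E (zc wbar) ->
  xc wbar = xc w + sigma *: (B1 (yc w) + B2 (zc wbar) - c) ->
  is_argmin (fun y => augLag B1 B2 c sigma f1 f2 y (zc wbar) (xc wbar)
        + (2^-1 * seminorm_op T1 (y - yc w) ^+ 2)%:E)%E (yc wbar) ->
  KKTop wbar (M (w - wbar)).
Proof.
move=> zmin xE ymin.
have h2 : subdiff f2 (zc wbar) (T2 (zc w - zc wbar)
    - B2s (xc w + sigma *: (B2 (zc wbar) + (B1 (yc w) - c)))).
  apply: (@argmin_augLag_subdiff _ _ _ _ _ _ _ _ _ _ _ _ 0) => //.
  move=> u; have := zmin u; rewrite /augLag /= !add0e !add0r -!addeA -!EFinD.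
  have E z : B1 (yc w) + B2 z - c = B2 z + (B1 (yc w) - c).
    by rewrite addrAC addrC.
  by rewrite !E.
(* Finiteness of [f2 (zc wbar)] must come first: it is the constant [b] of the y-step. *)
have f2z := subdiff_fin_num hp2 h2.
have h1 : subdiff f1 (yc wbar) (T1 (yc w - yc wbar)
    - B1s (xc wbar + sigma *: (B1 (yc wbar) + (B2 (zc wbar) - c)))).
  apply: (@argmin_augLag_subdiff _ _ _ _ _ _ _ _ _ _ _ _ (fine (f2 (zc wbar)))) => //.
  move=> u; have := ymin u; rewrite /augLag /= -(fineK f2z) -!addeA -!EFinD.
  by rewrite !addrA.
have M1 : yc (M (w - wbar)) = sigma *: B1s (B1 (yc w - yc wbar))
    + T1 (yc w - yc wbar) + B1s (xc w - xc wbar) by [].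
have M2 : zc (M (w - wbar)) = T2 (zc w - zc wbar) by [].
have M3 : xc (M (w - wbar)) = B1 (yc w - yc wbar)
   + sigma^-1 *: (xc w - xc wbar) by [].
have s0 : sigma != 0 by rewrite gt_eqF.
split.
(* By [xE], [sigma (B1 y + B2 zbar - c) = xbar - x]; this turns the multiplier in [h1] into the
   entries of [M]. *)
- rewrite M1; move: h1; congr subdiff; apply: dot_ext => u.
  rewrite xE !dE !(dotC (B1s _)) -!hB1s !dE !linearB !dE; ring.
- rewrite M2; move: h2; congr subdiff; apply: dot_ext => u.
  rewrite xE !dE !(dotC (B2s _)) -!hB2s !dE; ring.
rewrite M3; apply: dot_ext => u.
by rewrite xE !linearB !dE; field.
Qed.

(** Block factorization of [M]: the [B1] and multiplier blocks form one square. Each of the three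
    summands is therefore bounded by the squared seminorm. *)
Lemma dotME (d : W) : dotM d d = dot (yc d) (T1 (yc d))
  + dot (zc d) (T2 (zc d)) + sigma * `|xc (M d)| ^+ 2.
Proof.
have s0 : sigma != 0 by rewrite gt_eqF.
rewrite sqr_normE /dotM /dotW.
have -> : xc (M d) = B1 (yc d) + sigma^-1 *: xc d by [].
have -> : yc (M d) = sigma *: B1s (B1 (yc d)) + T1 (yc d) + B1s (xc d) by [].
have -> : zc (M d) = T2 (zc d) by [].
rewrite !dE -!hB1s (dotC (xc d)); field.
by [].
Qed.

Lemma dotM_semi_inner : semi_inner dotM.
Proof.
have [s1 p1] := hT1; have [s2 p2] := hT2.
split=> [u v|a u v t|u].
- have M1 (d : W) : yc (M d) = sigma *: B1s (B1 (yc d)) + T1 (yc d) + B1s (xc d) by [].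
  have M2 (d : W) : zc (M d) = T2 (zc d) by [].
  have M3 (d : W) : xc (M d) = B1 (yc d) + sigma^-1 *: xc d by [].
  rewrite /dotM /dotW !M1 !M2 !M3 !dE -!hB1s.
  rewrite -s1 -s2 (dotC (B1 (yc v)) (B1 _)) (dotC (xc v) (xc u)).
  rewrite (dotC (T1 _)) (dotC (T2 _)) (dotC (xc v)) (dotC (xc u)); ring.
- have -> : dotM (a *: u + v) t = dot (a *: yc u + yc v) (yc (M t))
    + dot (a *: zc u + zc v) (zc (M t)) + dot (a *: xc u + xc v) (xc (M t)) by [].
  rewrite /dotM /dotW !dE; ring.
by rewrite dotME !addr_ge0 // mulr_ge0 ?sqr_ge0 // ltW.
Qed.

Lemma normM_ge0 d : 0 <= normMs d. Proof. exact: sqrtr_ge0. Qed.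

Lemma normM_sqr d : normMs d ^+ 2 = dotM d d.
Proof. by rewrite sqr_sqrtr // (semi_inner_ge0 dotM_semi_inner). Qed.

Let sqrt_sigma_gt0 : 0 < Num.sqrt sigma. Proof. by rewrite sqrtr_gt0. Qed.

Lemma norm_opM_x d : `|xc (M d)| <= normMs d / Num.sqrt sigma.
Proof.
rewrite ler_pdivlMr // -(@ler_pXn2r _ 2) ?nnegrE ?mulr_ge0 ?normM_ge0 ?sqrtr_ge0 //.
rewrite exprMn sqr_sqrtr ?(ltW hsigma) // normM_sqr dotME mulrC lerDr.
by rewrite addr_ge0 //; [case: hT1 | case: hT2].
Qed.

(** Write [T v = S (S v)] and use [|S v|^2 = <v, T v>]. *)
Lemma norm_sqrt_op {V : euclideanType R} (T S : 'End(V)) (d : W) (v : V) :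
  is_sqrt_op T S -> dot v (T v) <= dotM d d -> `|T v| <= opnorm S * normMs d.
Proof.
move=> [[Ss _] ST] h.
have -> : T v = S (S v) by rewrite -ST comp_lfunE.
apply: le_trans (le_opnorm S _) _; rewrite ler_wpM2l ?opnorm_ge0 //.
rewrite -(@ler_pXn2r _ 2) ?nnegrE ?normM_ge0 // normM_sqr sqr_normE Ss.
by apply: le_trans h; rewrite -ST comp_lfunE.
Qed.

(** * Bounds on the KKT residual and the objective gap *)

Section Bounds.
Variables (S1 : 'End(Y)) (S2 : 'End(Z)).
Hypotheses (hS1 : is_sqrt_op T1 S1) (hS2 : is_sqrt_op T2 S2).

Let sv3_ge0 d : 0 <= sigma * `|xc (M d)| ^+ 2.
Proof. by rewrite mulr_ge0 ?sqr_ge0 // ltW. Qed.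

Lemma norm_opM_z d : `|zc (M d)| <= opnorm S2 * normMs d.
Proof.
apply: (norm_sqrt_op hS2); rewrite dotME.
have [_ p1] := hT1; have := p1 (yc d); have := sv3_ge0 d; lra.
Qed.

Lemma norm_opM_y d :
  `|yc (M d)| <= (sigma * opnorm B1s / Num.sqrt sigma + opnorm S1) * normMs d.
Proof.
(* Factoring out the third component of [M d] lets its bound be reused. *)
have -> : yc (M d) = sigma *: B1s (xc (M d)) + T1 (yc d).
  have -> : xc (M d) = B1 (yc d) + sigma^-1 *: xc d by [].
  rewrite linearD linearZ scalerDr scalerA mulfV ?gt_eqF // scale1r addrAC.
  by [].
apply: le_trans (ler_normD _ _) _; rewrite mulrDl lerD //; last first.
  apply: (norm_sqrt_op hS1); rewrite dotME.
  have [_ p2] := hT2; have := p2 (zc d); have := sv3_ge0 d; lra.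
rewrite normrZ (gtr0_norm hsigma) -!mulrA ler_wpM2l ?(ltW hsigma) //.
apply: le_trans (le_opnorm _ _) _; rewrite ler_wpM2l ?opnorm_ge0 //.
by rewrite mulrC norm_opM_x.
Qed.

Lemma normW_le (w : W) : normW w <= `|yc w| + `|zc w| + `|xc w|.
Proof.
rewrite -[leRHS]ger0_norm ?addr_ge0 // -sqrtr_sqr ler_sqrt ?sqr_ge0 //.
rewrite /dotW -!sqr_normE.
have yz := mulr_ge0 (normr_ge0 (yc w)) (normr_ge0 (zc w)).
have yx := mulr_ge0 (normr_ge0 (yc w)) (normr_ge0 (xc w)).
have zx := mulr_ge0 (normr_ge0 (zc w)) (normr_ge0 (xc w)).
lra.
Qed.

(** Each residual component is at most the matching component of [M d], by nonexpansiveness of the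
    prox. In the constant, the 1 comes from the third component and [sigma * opnorm B1s] from the
    first. *)
Lemma KKTres_le w d : KKTop w (M d) ->
  normW (KKTres f1 f2 B1 B2 B1s B2s c w)
  <= ((sigma * opnorm B1s + 1) / Num.sqrt sigma + opnorm S2 + opnorm S1)
     * normMs d.
Proof.
move=> [h1 h2 h3]; apply: le_trans (normW_le _) _.
have r1 : `|yc (KKTres f1 f2 B1 B2 B1s B2s c w)| <= `|yc (M d)|.
  apply: le_trans (prox_residual_le (- B1s (xc w)) hf1 h1) _.
  by rewrite distrC opprK subrK.
have r2 : `|zc (KKTres f1 f2 B1 B2 B1s B2s c w)| <= `|zc (M d)|.
  apply: le_trans (prox_residual_le (- B2s (xc w)) hf2 h2) _.
  by rewrite distrC opprK subrK.
have r3 : xc (KKTres f1 f2 B1 B2 B1s B2s c w) = xc (M d) by rewrite h3.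
rewrite r3; have := norm_opM_x d; have := norm_opM_y d; have := norm_opM_z d.
rewrite !mulrDl; lra.
Qed.

End Bounds.

(** Subgradients at [ws] give [r >= <x*, v>], with [v] the third component of [M d], the constraint
    violation at [w]. Subgradients at [w] give [r <= <w - ws, M d> + <x*, v>]. Cauchy-Schwarz bounds
    both. *)
Lemma obj_gap_bounds w d ws : KKTop w (M d) -> KKT f1 f2 B1 B2 B1s B2s c ws ->
  exists r : R, [/\ obj_gap f1 f2 w ws = r%:E,
    - (`|xc ws| * (normMs d / Num.sqrt sigma)) <= r &
    r <= normMs d * normMs (w - ws) + `|xc ws| * (normMs d / Num.sqrt sigma)].
Proof.
move=> [h1 h2 h3] [k1 k2 k3].
have f1w := subdiff_fin_num hp1 h1; have f2w := subdiff_fin_num hp2 h2.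
have f1s := subdiff_fin_num hp1 k1; have f2s := subdiff_fin_num hp2 k2.
exists (fine (f1 (yc w)) + fine (f2 (zc w)) - fine (f1 (yc ws)) - fine (f2 (zc ws))).
have xv : `|dot (xc ws) (xc (M d))| <= `|xc ws| * (normMs d / Num.sqrt sigma).
  apply: le_trans (dot_CauchySchwarz _ _) _.
  by rewrite ler_wpM2l // norm_opM_x.
have cE : c = B1 (yc ws) + B2 (zc ws) by apply/esym/eqP; rewrite -subr_eq0 k3.
have vE : xc (M d) = B1 (yc ws - yc w) + B2 (zc ws - zc w).
  rewrite h3 cE !linearB; apply: dot_ext => u; rewrite !dE; ring.
split.
- by rewrite /obj_gap -(fineK f1w) -(fineK f2w) -(fineK f1s) -(fineK f2s).
- have := k1 (yc w); have := k2 (zc w); rewrite /=.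
  rewrite -(fineK f1w) -(fineK f2w) -(fineK f1s) -(fineK f2s) -!EFinD !lee_fin.
  rewrite !(semi_innerNl (dot_semi_inner _)) !(dotC (B1s _)) !(dotC (B2s _)) -hB1s -hB2s.
  have : dot (xc ws) (xc (M d)) = - dot (B1 (yc w - yc ws)) (xc ws)
     - dot (B2 (zc w - zc ws)) (xc ws).
    by rewrite dotC vE -(opprB (yc w)) -(opprB (zc w)) !linearN !dE.
  move: xv; rewrite ler_norml => /andP[]; lra.
have := h1 (yc ws); have := h2 (zc ws); rewrite /=.
rewrite -(fineK f1w) -(fineK f2w) -(fineK f1s) -(fineK f2s) -!EFinD !lee_fin.
have CS : dotM (w - ws) d <= normMs d * normMs (w - ws).
  by rewrite mulrC; exact: (semi_inner_le dotM_semi_inner).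
have : dotM (w - ws) d = - dot (yc (M d) - B1s (xc w)) (yc ws - yc w)
     - dot (zc (M d) - B2s (xc w)) (zc ws - zc w) - dot (xc ws) (xc (M d)).
  have -> : dotM (w - ws) d = dot (yc w - yc ws) (yc (M d))
    + dot (zc w - zc ws) (zc (M d)) + dot (xc w - xc ws) (xc (M d)) by [].
  rewrite !(dotC _ (xc (M d))) vE -(opprB (yc ws)) -(opprB (zc ws)).
  move: (yc ws - yc w) (zc ws - zc w) (yc (M d)) (zc (M d)) => y z p r.
  rewrite !dE !(dotC (B1s _)) !(dotC (B2s _)) -hB1s -hB2s (dotC p) (dotC r); ring.
move: xv; rewrite ler_norml => /andP[]; lra.
Qed.

Lemma KKTop_closed (w v : nat -> W) (ws : W) :
  (forall k, KKTop (w k) (v k)) -> w @ \oo --> ws ->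
  (yc (v k) @[k --> \oo] --> (0 : Y)) -> (zc (v k) @[k --> \oo] --> (0 : Z)) ->
  (xc (v k) @[k --> \oo] --> (0 : X)) -> KKT f1 f2 B1 B2 B1s B2s c ws.
Proof.
move=> hw cw v1 v2 v3.
have cy : yc (w k) @[k --> \oo] --> yc ws.
  by apply: (cvg_comp _ _ (cvg_comp _ _ cw cvg_fst) cvg_fst).
have cz : zc (w k) @[k --> \oo] --> zc ws.
  by apply: (cvg_comp _ _ (cvg_comp _ _ cw cvg_fst) cvg_snd).
have cx : xc (w k) @[k --> \oo] --> xc ws.
  by apply: (cvg_comp _ _ cw cvg_snd).
have hom_cvg (U V : euclideanType R) (A : 'Hom(U, V)) (u : nat -> U) (l : U) :
    u @ \oo --> l -> A (u k) @[k --> \oo] --> A l.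
  by move=> ul; apply: (cvg_comp _ _ ul); exact: hom_continuous.
have [_ l1 _] := hf1; have [_ l2 _] := hf2.
have hs1 k : subdiff f1 (yc (w k)) (yc (v k) - B1s (xc (w k))) by case: (hw k).
have hs2 k : subdiff f2 (zc (w k)) (zc (v k) - B2s (xc (w k))) by case: (hw k).
apply/KKTop0; split.
- exact: (subdiff_cvg hp1 l1 hs1 cy (cvgB v1 (hom_cvg _ _ B1s _ _ cx))).
- exact: (subdiff_cvg hp2 l2 hs2 cz (cvgB v2 (hom_cvg _ _ B2s _ _ cx))).
have v3E k : xc (v k) = c - B1 (yc (w k)) - B2 (zc (w k)) by case: (hw k).
have h : xc (v k) @[k --> \oo] --> c - B1 (yc ws) - B2 (zc ws).
  under eq_cvg do rewrite v3E.
  apply: cvgB; last exact: hom_cvg.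
  by apply: cvgB; [exact: cvg_cst | exact: hom_cvg].
exact: (cvg_unique (@norm_hausdorff _ X) v3 h).
Qed.

End KKTOperator.

(** * The accelerated pADMM *)

Lemma littleo_harmonic {R : realType} (e D : nat -> R) (K : R) :
  0 <= K -> (forall k, `|e k| <= K * D k) ->
  (forall eps, 0 < eps -> \forall k \near \oo, k.+1%:R * D k <= eps) ->
  e =o_\oo (@harmonic R).
Proof.
move=> K0 eD HD; apply/eqoP => eps eps0.
have K1 : 0 < K + 1 by rewrite ltr_wpDl.
have d0 : 0 < eps / (K + 1) by rewrite divr_gt0.
apply: filterS (HD _ d0) => k hk; apply: le_trans (eD k) _.
have k0 : 0 < k.+1%:R :> R by rewrite ltr0n.
rewrite /harmonic ger0_norm ?invr_ge0 // ler_pdivlMr // -mulrA (mulrC (D k)).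
apply: le_trans (ler_wpM2l K0 hk) _.
by rewrite mulrCA ler_piMr ?(ltW eps0) // ler_pdivrMr // mul1r lerDl.
Qed.

Lemma norm_le_cvg0 {R : realType} {V : normedModType R} (f : nat -> V)
    (D : nat -> R) (K : R) :
  (forall k, `|f k| <= K * D k) -> D @ \oo --> (0 : R) -> f @ \oo --> (0 : V).
Proof.
move=> fD D0; apply/norm_cvg0P; apply: (@squeeze_cvgr _ _ _ _ (cst 0) (fun k => K * D k)).
- by apply: nearW => k; rewrite normr_ge0 fD.
- exact: cvg_cst.
by rewrite -(mulr0 K); apply: cvgM => //; exact: cvg_cst.
Qed.

Lemma opMB {R : realType} {X Y Z : euclideanType R} (B1 : 'Hom(Y, X))
    (B1s : 'Hom(X, Y)) (T1 : 'End(Y)) (T2 : 'End(Z)) (sigma : R)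
    (a b : Y * Z * X) :
  opM B1 B1s T1 T2 sigma (a - b)
  = opM B1 B1s T1 T2 sigma a - opM B1 B1s T1 T2 sigma b.
Proof.
rewrite /opM.
have -> : yc (a - b) = yc a - yc b by [].
have -> : zc (a - b) = zc a - zc b by [].
have -> : xc (a - b) = xc a - xc b by [].
rewrite !linearB; congr (_, _, _); apply: dot_ext => u; rewrite !dotE /=; ring.
Qed.

Section AcceleratedPADMM.
Context {R : realType} {X Y Z : euclideanType R}.
Variables (f1 : Y -> \bar R) (f2 : Z -> \bar R).
Variables (B1 : 'Hom(Y, X)) (B2 : 'Hom(Z, X)).
Variables (B1s : 'Hom(X, Y)) (B2s : 'Hom(X, Z)) (c : X).
Variables (T1 S1 : 'End(Y)) (T2 S2 : 'End(Z)) (sigma alpha rho : R).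
Hypotheses (hf1 : proper_closed_convex f1) (hf2 : proper_closed_convex f2)
  (hB1s : is_adjoint B1 B1s) (hB2s : is_adjoint B2 B2s)
  (hT1 : psd_op T1) (hT2 : psd_op T2)
  (hS1 : is_sqrt_op T1 S1) (hS2 : is_sqrt_op T2 S2)
  (hsigma : 0 < sigma) (halpha : 2 <= alpha) (hrho : 0 < rho <= 2).
Variables (w wbar what : nat -> Y * Z * X).
Hypothesis hADMM :
  accelerated_pADMM f1 f2 B1 B2 c T1 T2 sigma alpha rho w wbar what.

Local Notation M := (opM B1 B1s T1 T2 sigma).
Local Notation nM := (normM B1 B1s T1 T2 sigma).
Local Notation qM := (dotM B1 B1s T1 T2 sigma).
Local Notation KKTp := (KKT f1 f2 B1 B2 B1s B2s c).

Let Hq : semi_inner qM := dotM_semi_inner hB1s hT1 hT2 hsigma.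
Let D k := nM (w k - wbar k).

Lemma pADMM_KKTop k : KKTop f1 f2 B1 B2 B1s B2s c (wbar k) (M (w k - wbar k)).
Proof.
case: hADMM => _ _ _ /(_ k) [zmin xE ymin _ _].
exact: pADMM_step_KKTop zmin xE ymin.
Qed.

Let whatS k : what k.+1 = (1 - rho) *: w k + rho *: wbar k.
Proof. by case: hADMM => _ _ _ /(_ k) []. Qed.

Let wS k : w k.+1 = w k
   + (alpha / (2 * (k%:R + alpha))) *: (what k.+1 - w k)
   + (k%:R / (k%:R + alpha)) *: (what k.+1 - what k).
Proof. by case: hADMM => _ _ _ /(_ k) []. Qed.

Let mono j k : 0 <= qM ((w j - wbar j) - (w k - wbar k)) (wbar j - wbar k).
Proof.
have := KKTop_monotone hf1 hf2 hB1s hB2s (pADMM_KKTop j) (pADMM_KKTop k).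
by rewrite -opMB dotWC (semi_innerC Hq).
Qed.

Let mono_sol ws : KKTp ws -> forall k, 0 <= qM (w k - wbar k) (wbar k - ws).
Proof.
move=> /KKTop0 hws k.
have := KKTop_monotone hf1 hf2 hB1s hB2s (pADMM_KKTop k) hws.
by rewrite subr0 dotWC (semi_innerC Hq).
Qed.

Lemma pADMM2_rate ws k : KKTp ws -> alpha = 2 ->
  D k <= 2 * nM (w 0%N - ws) / (rho * k.+1%:R).
Proof.
move=> hws a2.
exact: (accelerated2_proximal_rate Hq halpha hrho whatS wS mono (mono_sol hws)).
Qed.

Lemma pADMM_rate ws (eps : R) : KKTp ws -> 2 < alpha -> 0 < eps ->
  \forall k \near \oo, k.+1%:R * D k <= eps.
Proof.
move=> hws a2 eps0.
exact: (accelerated_proximal_rate Hq halpha hrho whatS wS mono (mono_sol hws)).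
Qed.

Lemma pADMM2_dist ws k : KKTp ws -> alpha = 2 ->
  nM (wbar k - ws) <= nM (w 0%N - ws).
Proof.
move=> hws a2.
exact: (accelerated2_proximal_dist Hq halpha hrho whatS wS (mono_sol hws)).
Qed.

Lemma pADMM_dist ws : KKTp ws -> 2 < alpha ->
  exists2 K : R, 0 <= K & forall k, nM (wbar k - ws) <= K.
Proof.
move=> hws a2.
exact: (accelerated_proximal_dist Hq halpha hrho whatS wS (mono_sol hws)).
Qed.

Lemma pADMM_cvg0 ws : KKTp ws -> D @ \oo --> (0 : R).
Proof.
move=> hws; have D0 k : 0 <= D k by exact: normM_ge0.
have [a2|a2] := eqVneq alpha 2.
  apply: (@norm_le_cvg0 _ R _ (@harmonic R) (2 * nM (w 0%N - ws) / rho)).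
    move=> k; rewrite ger0_norm //; apply: le_trans (pADMM2_rate k hws a2) _.
    by rewrite /harmonic invfM mulrA.
  exact: cvg_harmonic.
have {}a2 : 2 < alpha by rewrite lt_def a2.
apply/cvgrPdist_le => eps eps0; apply: filterS (pADMM_rate hws a2 eps0) => k.
rewrite sub0r normrN ger0_norm //; apply: le_trans.
by rewrite ler_peMl // ler1n.
Qed.

(** The auxiliary KKT point [ws] only supplies the decay of [D]; afterwards the estimates can be
    centred at [wstar] itself. *)
Lemma pADMM_limit_KKT ws wstar : KKTp ws -> wbar @ \oo --> wstar -> KKTp wstar.
Proof.
move=> hws hlim; have D0 := pADMM_cvg0 hws.
apply: (KKTop_closed hf1 hf2 pADMM_KKTop hlim).
- exact: (norm_le_cvg0
    (fun k => norm_opM_y hB1s hT1 hT2 hsigma hS1 (w k - wbar k)) D0).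
- exact: (norm_le_cvg0
    (fun k => norm_opM_z hB1s hT1 hT2 hsigma hS2 (w k - wbar k)) D0).
have h k : `|xc (M (w k - wbar k))| <= (Num.sqrt sigma)^-1 * D k.
  by rewrite mulrC norm_opM_x.
exact: (norm_le_cvg0 h D0).
Qed.

End AcceleratedPADMM.

Unset Implicit Arguments.

Theorem theorem3p7 (R : realType) (X Y Z : euclideanType R)
  (f1 : Y -> \bar R) (f2 : Z -> \bar R)
  (hf1 : proper_closed_convex f1) (hf2 : proper_closed_convex f2)
  (B1 : 'Hom(Y, X)) (B2 : 'Hom(Z, X)) (B1s : 'Hom(X, Y)) (B2s : 'Hom(X, Z))
  (hB1s : is_adjoint B1 B1s) (hB2s : is_adjoint B2 B2s) (c : X)
  (T1 : 'End(Y)) (T2 : 'End(Z)) (hT1 : psd_op T1) (hT2 : psd_op T2)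
  (sqrtT1 : 'End(Y)) (sqrtT2 : 'End(Z))
  (hsqrtT1 : is_sqrt_op T1 sqrtT1) (hsqrtT2 : is_sqrt_op T2 sqrtT2)
  (Sigma1 : 'End(Y)) (Sigma2 : 'End(Z))
  (hSigma1 : psd_op Sigma1) (hSigma2 : psd_op Sigma2)
  (hf1Sigma : convexity_modulus f1 Sigma1)
  (hf2Sigma : convexity_modulus f2 Sigma2)
  (sigma alpha rho : R)
  (hsigma : 0 < sigma) (halpha : 2 <= alpha) (hrho : 0 < rho <= 2)
  (hKKT : exists w, KKT f1 f2 B1 B2 B1s B2s c w)
  (hpd1 : pd_op (Sigma1 + (B1s \o B1)%VF + T1))
  (hpd2 : pd_op (Sigma2 + (B2s \o B2)%VF + T2))
  (w wbar what : nat -> Y * Z * X)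
  (hADMM : accelerated_pADMM f1 f2 B1 B2 c T1 T2 sigma alpha rho w wbar what)
  (wstar : Y * Z * X) (hlim : wbar @ \oo --> wstar) :
  let R0 := normM B1 B1s T1 T2 sigma (w 0%N - wstar) in
  let res k := normW (KKTres f1 f2 B1 B2 B1s B2s c (wbar k)) in
  let h k := obj_gap f1 f2 (wbar k) wstar in
  let C := (sigma * opnorm B1s + 1) / Num.sqrt sigma
           + opnorm sqrtT2 + opnorm sqrtT1 in
  (alpha = 2 -> forall k : nat,
    res k <= C * (2 * R0 / (rho * k.+1%:R)) /\
    ((- 1 / Num.sqrt sigma * `|xc wstar| * (2 * R0 / (rho * k.+1%:R)))%:E
        <= h k)%E /\
    (h k <= ((3 * R0 + 1 / Num.sqrt sigma * `|xc wstar|)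
              * (2 * R0 / (rho * k.+1%:R)))%:E)%E)
  /\
  (2 < alpha ->
    (exists2 e : nat -> R, e =o_\oo (@harmonic R)
                         & forall k, res k = C * e k) /\
    (exists2 e : nat -> R, e =o_\oo (@harmonic R)
                         & forall k, `|h k|%E = (e k)%:E)).
Proof.
move=> R0 res h C.
have [w0 hw0] := hKKT.
(* From here on the rates are taken relative to [wstar], so that [R0] appears in them. *)
have hws := pADMM_limit_KKT hf1 hf2 hB1s hB2s hT1 hT2 hsqrtT1 hsqrtT2 hsigma
  halpha hrho hADMM hw0 hlim.
pose D k := normM B1 B1s T1 T2 sigma (w k - wbar k).
pose x0 := `|xc wstar| / Num.sqrt sigma.
have s0 : 0 < Num.sqrt sigma by rewrite sqrtr_gt0.
have x00 : 0 <= x0 by rewrite divr_ge0 // ltW.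
have D0 k : 0 <= D k by exact: normM_ge0.
have C0 : 0 < C.
  rewrite /C -addrA ltr_wpDr ?addr_ge0 ?opnorm_ge0 // divr_gt0 // ltr_wpDl //.
  by rewrite mulr_ge0 ?opnorm_ge0 // ltW.
have hK := pADMM_KKTop hf1 hf2 hB1s hB2s hT1 hT2 hsigma hADMM.
have resD k : res k <= C * D k by exact: KKTres_le (hK k).
have res0 k : 0 <= res k by exact: sqrtr_ge0.
have gap k : exists r : R, [/\ h k = r%:E, - (x0 * D k) <= r &
    r <= D k * normM B1 B1s T1 T2 sigma (wbar k - wstar) + x0 * D k].
  have [r [hr r1 r2]] := obj_gap_bounds hf1 hf2 hB1s hB2s hT1 hT2 hsigma (hK k) hws.
  have e : x0 * D k = `|xc wstar| * (D k / Num.sqrt sigma) by rewrite /x0 mulrAC mulrA.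
  by exists r; rewrite e.
have Hq := dotM_semi_inner hB1s hT1 hT2 hsigma.
split=> [a2 k|a2].
  have Dk : D k <= 2 * R0 / (rho * k.+1%:R).
    exact: (pADMM2_rate hf1 hf2 hB1s hB2s hT1 hT2 hsigma halpha hrho hADMM).
  set bd := 2 * R0 / _ in Dk *.
  have R00 : 0 <= R0 by exact: normM_ge0.
  split; first by apply: le_trans (resD k) _; rewrite ler_pM2l.
  have [r [-> r1 r2]] := gap k.
  have dist : normM B1 B1s T1 T2 sigma (wbar k - wstar) <= R0.
    exact: (pADMM2_dist hf1 hf2 hB1s hB2s hT1 hT2 hsigma halpha hrho hADMM).
  have x0D := ler_wpM2l x00 Dk.
  have x0E : 1 / Num.sqrt sigma * `|xc wstar| = x0 by rewrite mul1r mulrC.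
  rewrite !lee_fin; split.
    by rewrite mulNr mulNr x0E mulNr; lra.
  (* The estimate obtained is [(R0 + x0) * bd], which lies below the stated bound since [R0] and
     [bd] are nonnegative. *)
  rewrite x0E; have := ler_pM (D0 k) (normM_ge0 _ _ _ _ _ _) Dk dist.
  have := mulr_ge0 (le_trans (D0 k) Dk) R00; lra.
have Drate eps : 0 < eps -> \forall k \near \oo, k.+1%:R * D k <= eps.
  exact: (pADMM_rate hf1 hf2 hB1s hB2s hT1 hT2 hsigma halpha hrho hADMM hws a2).
split.
  (* Division is legitimate: [C] is at least the inverse of [Num.sqrt sigma], hence positive. *)
  exists (fun k => res k / C); last by move=> k; rewrite mulrC divfK // gt_eqF.
  apply: (@littleo_harmonic _ _ D 1) => // k.
  by rewrite mul1r ger0_norm ?divr_ge0 ?(ltW C0) // ler_pdivrMr // mulrC.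
have [K K0 HK] := pADMM_dist hf1 hf2 hB1s hB2s hT1 hT2 hsigma halpha hrho hADMM hws a2.
(* By [gap] the objective gap is a real number, so [fine] loses nothing. *)
exists (fun k => fine `|h k|%E); last first.
  by move=> k; have [r [-> _ _]] := gap k.
apply: (@littleo_harmonic _ _ D (K + x0)) => //; first exact: addr_ge0.
move=> k; have [r [-> r1 r2]] := gap k; rewrite /= normr_id ler_norml.
have DK := ler_wpM2l (D0 k) (HK k).
have := mulr_ge0 K0 (D0 k).
by move=> KD; apply/andP; split; lra.
Qed.
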